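(* Let $n>1$, $Q=\mathrm{diag}(1,\dots,1,x)\in M_n(\Bbbk[x])$, $C=\mathrm{Cend}_{n,Q}$, and let $M$ be an arbitrary conformal bimodule over $C$. Then $\mathcal H^2(C,M)=0$.
   Context: $\Bbbk$ is an algebraically closed field of characteristic zero, $H=\Bbbk[\partial]$. An associative conformal algebra is a left $H$-module $C$ with a bilinear map ($\lambda$-product) $(\cdot_{(\lambda)}\cdot):C\otimes C\to C[\lambda]$ such that $(\partial a)_{(\lambda)}b=-\lambda(a_{(\lambda)}b)$, $a_{(\lambda)}(\partial b)=(\partial+\lambda)(a_{(\lambda)}b)$, and $a_{(\lambda)}(b_{(\mu)}c)=(a_{(\lambda)}b)_{(\lambda+\mu)}c$. $\mathrm{Cend}_n$ is $M_n(\Bbbk[\partial,x])$ with the multiplication action of $\partial$ and $A(\partial,x)_{(\lambda)}B(\partial,x)=A(-\lambda,x)B(\partial+\lambda,x+\lambda)$; $\mathrm{Cend}_{n,Q}=Q\,M_n(\Bbbk[\partial,x])$ is a conformal subalgebra of $\mathrm{Cend}_n$. A conformal bimodule over $C$ is a left $H$-module $M$ with bilinear maps $C\otimes M\to M[\lambda]$, $M\otimes C\to M[\lambda]$, both denoted $(\cdot_{(\lambda)}\cdot)$, satisfying the same identities $(\partial a)_{(\lambda)}b=-\lambda(a_{(\lambda)}b)$, $a_{(\lambda)}(\partial b)=(\partial+\lambda)(a_{(\lambda)}b)$ and $a_{(\lambda)}(b_{(\mu)}c)=(a_{(\lambda)}b)_{(\lambda+\mu)}c$ whenever exactly one of the arguments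 is in $M$ and the others are in $C$. $\mathcal Z^2(C,M)$ is the space of bilinear maps $\varphi_\lambda:C\otimes C\to M[\lambda]$ with $\varphi_\lambda(\partial a,b)=-\lambda\varphi_\lambda(a,b)$, $\varphi_\lambda(a,\partial b)=(\partial+\lambda)\varphi_\lambda(a,b)$ and $$a_{(\lambda)}\varphi_\mu(b,c)-\varphi_{\lambda+\mu}(a_{(\lambda)}b,c)+\varphi_\lambda(a,b_{(\mu)}c)-\varphi_\lambda(a,b)_{(\lambda+\mu)}c=0$$ for all $a,b,c\in C$. $\mathcal B^2(C,M)$ is the space of maps $(d_1\tau)_\lambda(a,b)=a_{(\lambda)}\tau(b)-\tau(a_{(\lambda)}b)+\tau(a)_{(\lambda)}b$, where $\tau:C\to M$ is $H$-linear (extended coefficientwise to polynomials in $\lambda$). $\mathcal H^2(C,M)=\mathcal Z^2(C,M)/\mathcal B^2(C,M)$. *)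

(* Defs.v *)
From HB Require Import structures.
From mathcomp Require Import all_boot all_order all_algebra ring_quotient.
From mathcomp Require Import boolp functions.

Set Implicit Arguments.
Unset Strict Implicit.
Unset Printing Implicit Defensive.

Import GRing.Theory.
Local Open Scope ring_scope.

(* H = k[∂] is {poly k}, so a left H-module is an lmodType {poly k}, on which
   ∂ acts as 'X *: _ and a scalar c of k acts as c%:P *: _.

   An element of W[λ] is encoded by the sequence nat -> W of its coefficients,
   which has to vanish from some rank on. A map U (x) V -> W[λ] is thus a
   function f : U -> V -> nat -> W, with f a b i the coefficient of λ^i. *)

Section LambdaPolynomials.
Variable W : nmodType.

Definition lpoly (p : nat -> W) := exists N, forall i, (N <= i)%N -> p i = 0.

(* p |-> λ p *)
Definition mul_lambda (p : nat -> W) : nat -> W :=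
  fun i => if i is j.+1 then p j else 0.

End LambdaPolynomials.

Record sesquilinear (k : fieldType) (U V W : lmodType {poly k})
    (f : U -> V -> nat -> W) : Prop := Sesquilinear {
  sesq_lpoly : forall a b, lpoly (f a b);
  sesq_linl : forall (c : k) a a' b i,
    f (c%:P *: a + a') b i = c%:P *: f a b i + f a' b i;
  sesq_linr : forall (c : k) a b b' i,
    f a (c%:P *: b + b') i = c%:P *: f a b i + f a b' i;
  sesq_dl : forall a b i, f ('X *: a) b i = - mul_lambda (f a b) i;
  sesq_dr : forall a b i, f a ('X *: b) i = 'X *: f a b i + mul_lambda (f a b) i
}.

Section Compositions.
Variables U V W UV VW X : nmodType.

(* nested f g a b c i j is the coefficient of λ^i μ^j in f_λ(a, g_μ(b, c)). *)
Definition nested (f : U -> VW -> nat -> X) (g : V -> W -> nat -> VW)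
    a b c (i j : nat) : X :=
  f a (g b c j) i.

(* shifted f g a b c i j is the coefficient of λ^i μ^j in f_{λ+μ}(g_λ(a, b), c),
   i.e., in the sum over l and m of λ^l (λ + μ)^m f_m(g_l(a, b), c): one must
   have m = i - l + j, and the monomial λ^(i - l) μ^j of (λ + μ)^m has
   coefficient 'C(m, j). *)
Definition shifted (f : UV -> W -> nat -> X) (g : U -> V -> nat -> UV)
    a b c (i j : nat) : X :=
  \sum_(l < i.+1) f (g a b l) c (i - l + j)%N *+ 'C(i - l + j, j).

End Compositions.

(* lprod a b i is the coefficient of λ^i in a_(λ) b. *)
HB.mixin Record isConfAlg (k : fieldType) C of GRing.Lmodule {poly k} C := {
  lprod : C -> C -> nat -> C;
  lprod_sesquilinear : sesquilinear lprod;
  lprodA : forall a b c i j,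
    nested lprod lprod a b c i j = shifted lprod lprod a b c i j
}.

#[short(type="confAlgType")]
HB.structure Definition ConfAlg (k : fieldType) :=
  {C of GRing.Lmodule {poly k} C & isConfAlg k C}.

HB.mixin Record isConfBimod (k : fieldType) (C : confAlgType k) M
    of GRing.Lmodule {poly k} M := {
  lact : C -> M -> nat -> M;
  ract : M -> C -> nat -> M;
  lact_sesquilinear : sesquilinear lact;
  ract_sesquilinear : sesquilinear ract;
  lactA : forall a b m i j,
    nested lact lact a b m i j = shifted lact (@lprod k C) a b m i j;
  lractA : forall a m b i j,
    nested lact ract a m b i j = shifted ract lact a m b i j;
  ractA : forall m a b i j,
    nested ract (@lprod k C) m a b i j = shifted ract ract m a b i j
}.

#[short(type="confBimodType")]
HB.structure Definition ConfBimod (k : fieldType) (C : confAlgType k) :=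
  {M of GRing.Lmodule {poly k} M & isConfBimod k C M}.

Section Cohomology.
Variables (k : fieldType) (C : confAlgType k) (M : confBimodType C).

Local Notation lprod := (@lprod k C).
Local Notation lact := (@lact k C M).
Local Notation ract := (@ract k C M).

Definition cochain2 := C -> C -> nat -> M.
HB.instance Definition _ := GRing.Zmodule.on cochain2.

Record cocycle2 (phi : cochain2) : Prop := Cocycle2 {
  cocycle2_sesquilinear : sesquilinear phi;
  cocycle2E : forall a b c i j,
    nested lact phi a b c i j - shifted phi lprod a b c i j
    + nested phi lprod a b c i j - shifted ract phi a b c i j = 0
}.

Definition d1 (tau : {linear C -> M}) : cochain2 := fun a b i =>
  lact a (tau b) i - tau (lprod a b i) + ract (tau a) b i.

Lemma sesqBl (U V W : lmodType {poly k}) (f : U -> V -> nat -> W) :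
  sesquilinear f -> forall a a' b i, f (a - a') b i = f a b i - f a' b i.
Proof.
move=> hf a a' b i; have := sesq_linl hf (-1) a' a b i.
by rewrite polyCN !scaleN1r addrC => ->; rewrite addrC.
Qed.

Lemma sesqBr (U V W : lmodType {poly k}) (f : U -> V -> nat -> W) :
  sesquilinear f -> forall a b b' i, f a (b - b') i = f a b i - f a b' i.
Proof.
move=> hf a b b' i; have := sesq_linr hf (-1) a b' b i.
by rewrite polyCN !scaleN1r addrC => ->; rewrite addrC.
Qed.

Lemma mul_lambdaB (W : zmodType) (p q : nat -> W) i :
  mul_lambda (fun j => p j - q j) i = mul_lambda p i - mul_lambda q i.
Proof. by case: i => [|i] /=; rewrite ?subr0. Qed.

Lemma cochain2BE (f g : cochain2) a b i : (f - g) a b i = f a b i - g a b i.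
Proof. by []. Qed.

Lemma sesquilinear0 : sesquilinear (0 : cochain2).
Proof.
split.
- by move=> a b; exists 0%N.
- by move=> c a a' b i; rewrite /= scaler0 addr0.
- by move=> c a b b' i; rewrite /= scaler0 addr0.
- by move=> a b [|i]; rewrite /= oppr0.
- by move=> a b [|i]; rewrite /= scaler0 addr0.
Qed.

Lemma sesquilinearB (f g : cochain2) :
  sesquilinear f -> sesquilinear g -> sesquilinear (f - g).
Proof.
move=> hf hg; split.
- move=> a b; have [N hN] := sesq_lpoly hf a b; have [P hP] := sesq_lpoly hg a b.
  exists (maxn N P) => i; rewrite geq_max => /andP[iN iP].
  by rewrite cochain2BE hN // hP // subr0.
- move=> c a a' b i.
  by rewrite !cochain2BE (sesq_linl hf) (sesq_linl hg) scalerBr opprD addrACA.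
- move=> c a b b' i.
  by rewrite !cochain2BE (sesq_linr hf) (sesq_linr hg) scalerBr opprD addrACA.
- move=> a b i; rewrite cochain2BE (sesq_dl hf) (sesq_dl hg).
  by rewrite -opprD mul_lambdaB.
- move=> a b i; rewrite !cochain2BE (sesq_dr hf) (sesq_dr hg) mul_lambdaB.
  by rewrite scalerBr opprD addrACA.
Qed.

Lemma cocycle2_0 : cocycle2 0.
Proof.
split; first exact: sesquilinear0.
move=> a b c i j; rewrite /nested /shifted /=.
have -> : lact a (0 : M) i = 0.
  by have := sesqBr lact_sesquilinear a (0 : M) 0 i; rewrite !subrr.
rewrite big1 => [|l _]; last by rewrite /= mul0rn.
rewrite big1 ?oppr0 ?addr0 // => l _.
have -> : ract (0 : M) c (i - l + j) = 0.
  by have := sesqBl ract_sesquilinear (0 : M) 0 c (i - l + j); rewrite !subrr.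
by rewrite mul0rn.
Qed.

Lemma cocycle2B (f g : cochain2) :
  cocycle2 f -> cocycle2 g -> cocycle2 (f - g).
Proof.
move=> [hf hfE] [hg hgE]; split; first exact: sesquilinearB.
move=> a b c i j; rewrite -[RHS]subr0 -{1}(hfE a b c i j) -(hgE a b c i j).
have -> : nested lact (f - g) a b c i j
          = nested lact f a b c i j - nested lact g a b c i j.
  by rewrite /nested cochain2BE (sesqBr lact_sesquilinear).
have -> : nested (f - g) lprod a b c i j
          = nested f lprod a b c i j - nested g lprod a b c i j by [].
have -> : shifted (f - g) lprod a b c i j
          = shifted f lprod a b c i j - shifted g lprod a b c i j.
  by rewrite /shifted -sumrB; apply: eq_bigr => l _; rewrite -mulrnBl.
have -> : shifted ract (f - g) a b c i j
          = shifted ract f a b c i j - shifted ract g a b c i j.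
  rewrite /shifted -sumrB; apply: eq_bigr => l _.
  by rewrite cochain2BE (sesqBl ract_sesquilinear) -mulrnBl.
rewrite !opprD !opprK [RHS]addrACA; congr (_ + _).
by rewrite [RHS]addrACA; congr (_ + _); rewrite [RHS]addrACA.
Qed.

Lemma d1_0 : d1 \0 = 0.
Proof.
apply/funext => a; apply/funext => b; apply/funext => i; rewrite /d1 /=.
have -> : lact a (0 : M) i = 0.
  by have := sesqBr lact_sesquilinear a (0 : M) 0 i; rewrite !subrr.
have -> : ract (0 : M) b i = 0.
  by have := sesqBl ract_sesquilinear (0 : M) 0 b i; rewrite !subrr.
by rewrite subr0 addr0.
Qed.

Lemma d1B (s t : {linear C -> M}) : d1 (s \- t) = d1 s - d1 t.
Proof.
apply/funext => a; apply/funext => b; apply/funext => i.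
rewrite cochain2BE /d1 /= (sesqBr lact_sesquilinear).
rewrite (sesqBl ract_sesquilinear) !opprD !opprK.
by rewrite [RHS]addrACA; congr (_ + _); rewrite addrACA.
Qed.

Definition in_Z2 : {pred cochain2} := fun phi => `[< cocycle2 phi >].

Lemma in_Z2_zmod_closed : zmod_closed in_Z2.
Proof.
split; first exact/asboolP/cocycle2_0.
by move=> f g /asboolP hf /asboolP hg; apply/asboolP/cocycle2B.
Qed.

HB.instance Definition _ := GRing.isZmodClosed.Build cochain2 in_Z2
  in_Z2_zmod_closed.

Record Z2 := MkZ2 { Z2val :> cochain2; Z2valP : Z2val \in in_Z2 }.

HB.instance Definition _ := [isSub for Z2val].
HB.instance Definition _ := [Choice of Z2 by <:].
HB.instance Definition _ := [SubChoice_isSubZmodule of Z2 by <:].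

(* The coboundaries form a predicate on Z2, as d1 tau is always a cocycle. *)
Definition B2 : {pred Z2} := fun phi => `[< exists tau, val phi = d1 tau >].

Lemma B2_zmod_closed : zmod_closed B2.
Proof.
split; first by apply/asboolP; exists \0; rewrite d1_0 raddf0.
move=> f g /asboolP[s hs] /asboolP[t ht]; apply/asboolP.
by exists (s \- t); rewrite d1B raddfB /= -hs -ht.
Qed.

HB.instance Definition _ := GRing.isZmodClosed.Build Z2 B2 B2_zmod_closed.

Definition H2 := {ideal_quot B2}.
HB.instance Definition _ := GRing.Zmodule.on H2.

End Cohomology.

(* k[∂, x] is {poly {poly k}}: the inner variable is ∂ and the outer one is x,
   so that H embeds as the constant polynomials in x. *)
Definition cend (k : fieldType) (n : nat) := 'M[{poly {poly k}}]_n.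

Section Cend.
Variables (k : fieldType) (n : nat).

Local Notation R := {poly {poly k}}.

HB.instance Definition _ := GRing.Zmodule.on (cend k n).

Definition cend_scale (p : {poly k}) (A : cend k n) : cend k n := p%:P *: A.

Fact cend_scaleA p q A : cend_scale p (cend_scale q A) = cend_scale (p * q) A.
Proof. by rewrite /cend_scale scalerA polyCM. Qed.

Fact cend_scale1 : left_id 1 cend_scale.
Proof. by move=> A; rewrite /cend_scale scale1r. Qed.

Fact cend_scaleDr : right_distributive cend_scale +%R.
Proof. by move=> p A B; rewrite /cend_scale scalerDr. Qed.

Fact cend_scaleDl A : {morph cend_scale^~ A : p q / p + q}.
Proof. by move=> p q; rewrite /cend_scale polyCD scalerDl. Qed.

HB.instance Definition _ := GRing.Zmodule_isLmodule.Build {poly k} (cend k n)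
  cend_scaleA cend_scale1 cend_scaleDr cend_scaleDl.

End Cend.

(* The value p(u, v) of p(∂, x), where iota embeds the scalars. *)
Definition eval2 (k : fieldType) (T : comNzRingType) (iota : {rmorphism k -> T})
    (u v : T) : {poly {poly k}} -> T :=
  horner_eval v \o map_poly (horner_eval u \o map_poly iota).

HB.instance Definition _ (k : fieldType) (T : comNzRingType)
  (iota : {rmorphism k -> T}) (u v : T) := GRing.RMorphism.on (eval2 iota u v).

Section TwoParameters.
Variable k : fieldType.

Local Notation R := {poly {poly k}}.

Lemma rmorph2_ext (T : comNzRingType) (f g : {rmorphism R -> T}) :
  (forall c, f c%:P%:P = g c%:P%:P) -> f 'X%:P = g 'X%:P -> f 'X = g 'X ->
  f =1 g.
Proof.
move=> hc hd hx; elim/poly_ind => [|p c IHp]; first by rewrite !rmorph0.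
rewrite !rmorphD !rmorphM IHp hx; congr (_ + _).
elim/poly_ind: c => [|c a IHc]; first by rewrite !rmorph0.
by rewrite polyCD polyCM !rmorphD !rmorphM IHc hd hc.
Qed.

Variables (U T : comNzRingType) (inj evl evr : {rmorphism R -> U}) (lam : U).
Hypothesis evlCC : forall c, evl c%:P%:P = inj c%:P%:P.
Hypothesis evlCX : evl 'X%:P = - lam.
Hypothesis evlX : evl 'X = inj 'X.
Hypothesis evrCC : forall c, evr c%:P%:P = inj c%:P%:P.
Hypothesis evrCX : evr 'X%:P = inj 'X%:P + lam.
Hypothesis evrX : evr 'X = inj 'X + lam.

Variables (injT addmu fuse lift : {rmorphism U -> T}) (mu : T).
Hypothesis addmuC : forall p, addmu (inj p) = injT (inj p).
Hypothesis addmuX : addmu lam = injT lam + mu.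
Hypothesis fuseC : forall p, fuse (inj p) = addmu (evl p).
Hypothesis fuseX : fuse lam = injT lam.
Hypothesis liftC : forall p, lift (inj p) = injT (evr p).
Hypothesis liftX : lift lam = mu.

Lemma fuse_evl p : fuse (evl p) = injT (evl p).
Proof.
apply: (@rmorph2_ext _ (fuse \o evl) (injT \o evl)) => [c||] /=.
- by rewrite evlCC fuseC evlCC addmuC.
- by rewrite evlCX !rmorphN fuseX.
- by rewrite evlX fuseC evlX addmuC.
Qed.

Lemma fuse_evr p : fuse (evr p) = lift (evl p).
Proof.
apply: (@rmorph2_ext _ (fuse \o evr) (lift \o evl)) => [c||] /=.
- by rewrite evrCC fuseC !evlCC addmuC liftC evrCC.
- rewrite evrCX evlCX rmorphD fuseC fuseX evlCX !rmorphN liftX addmuX.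
  by rewrite opprD addrAC addNr add0r.
- by rewrite evrX evlX rmorphD fuseC fuseX evlX addmuC liftC evrX rmorphD.
Qed.

Lemma addmu_evr p : addmu (evr p) = lift (evr p).
Proof.
apply: (@rmorph2_ext _ (addmu \o evr) (lift \o evr)) => [c||] /=.
- by rewrite evrCC addmuC liftC evrCC.
- by rewrite evrCX !rmorphD addmuC addmuX liftC liftX evrCX rmorphD addrA.
- by rewrite evrX !rmorphD addmuC addmuX liftC liftX evrX rmorphD addrA.
Qed.

End TwoParameters.

Lemma coef_exprXDX (R : comNzRingType) m i j :
  (('X%:P + 'X : {poly {poly R}}) ^+ m)`_j`_i = ((m == i + j)%N * 'C(m, j))%:R.
Proof.
rewrite exprDn !coef_sum.
have E (l : 'I_m.+1) : ('X%:P ^+ (m - l) * 'X ^+ l *+ 'C(m, l)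
     : {poly {poly R}})`_j`_i = ((j == l) * ((i == m - l)%N * 'C(m, l)))%:R.
  rewrite !coefMn -polyC_exp coefCM coefXn mulr_natr coefMn coefXn.
  by rewrite -!mulrnA mulnCA.
have [jm|mj] := leqP j m; last first.
  rewrite (bin_small mj) muln0 big1 // => l _.
  rewrite E; case: eqP => // jl; move: mj (ltn_ord l).
  by rewrite jl ltnNge -ltnS => /negP.
pose jo := Ordinal (jm : (j < m.+1)%N).
rewrite (bigD1 jo) // E /= eqxx mul1n big1 ?addr0 => [|l lj].
  by rewrite -(eqn_add2r j) subnK // eq_sym.
rewrite E; case: eqP => // jl; case/negP: lj.
by apply/eqP/val_inj.
Qed.

Lemma coef_hornerXDX (R : comNzRingType) (p : {poly R}) i j :
  ((map_poly (polyC \o polyC) p).['X%:P + 'X : {poly {poly R}}])`_j`_i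
  = p`_(i + j) *+ 'C(i + j, j).
Proof.
have E (l : nat) : ((map_poly (polyC \o polyC) p)`_l
    * ('X%:P + 'X : {poly {poly R}}) ^+ l)`_j`_i
    = p`_l *+ ((l == i + j)%N * 'C(l, j)).
  by rewrite coef_map !coefCM coef_exprXDX mulr_natr.
rewrite (horner_coef_wide _ (size_poly _ _)) !coef_sum.
under eq_bigr => l _ do rewrite E.
have [ij|ij] := ltnP (i + j) (size p); last first.
  rewrite nth_default // mul0rn big1 // => l _.
  by rewrite ltn_eqF ?mulr0n // (leq_trans (ltn_ord l)).
rewrite (bigD1 (Ordinal ij)) //= eqxx mul1n big1 ?addr0 // => l lij.
by rewrite (_ : (l == i + j :> nat) = false) //; apply/negbTE.
Qed.

Section TwoStepProduct.
Variables (R : comNzRingType) (evl evr : {rmorphism R -> {poly R}}).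

Local Notation T := {poly {poly R}}.

Definition addmu : {rmorphism {poly R} -> T} :=
  horner_eval ('X%:P + 'X) \o map_poly (polyC \o polyC).
Definition fuse : {rmorphism {poly R} -> T} :=
  horner_eval 'X%:P \o map_poly (addmu \o evl).

Lemma addmuC p : addmu p%:P = p%:P%:P.
Proof. by rewrite /addmu /= map_polyC horner_evalE hornerC. Qed.

Lemma addmuX : addmu 'X = 'X%:P + 'X.
Proof. by rewrite /addmu /= map_polyX horner_evalE hornerX. Qed.

Lemma fuseC p : fuse p%:P = addmu (evl p).
Proof. by rewrite /fuse [LHS]/= map_polyC horner_evalE hornerC. Qed.

Lemma fuseX : fuse 'X = 'X%:P.
Proof. by rewrite /fuse [LHS]/= map_polyX horner_evalE hornerX. Qed.

Lemma coef_addmu p i j : (addmu p)`_j`_i = p`_(i + j) *+ 'C(i + j, j).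
Proof. exact: coef_hornerXDX. Qed.

Lemma coef_fuse q w i j : (fuse q * addmu w)`_j`_i =
  \sum_(l < i.+1) (evl q`_l * w)`_(i - l + j) *+ 'C(i - l + j, j).
Proof.
have -> : fuse q = (map_poly (addmu \o evl) q).['X%:P] by [].
pose N := maxn (size q) i.+1.
have qN : (size (map_poly (addmu \o evl) q) <= N)%N.
  by rewrite (leq_trans (size_poly _ _)) ?leq_maxl.
rewrite (horner_coef_wide _ qN) mulr_suml !coef_sum.
rewrite (big_ord_widen N (fun l => (evl q`_l * w)`_(i - l + j)
  *+ 'C(i - l + j, j))) ?leq_maxr // [RHS]big_mkcond.
apply: eq_bigr => l _.
rewrite coef_map [X in X * _ * _](_ : _ = addmu (evl q`_l)) //.
rewrite mulrAC -rmorphM mulrC -polyC_exp coefCM coefXnM ltnS ltnNge.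
by case: leqP => // _; rewrite coef_addmu.
Qed.

Variable n : nat.
Implicit Types A B D : 'M[R]_n.

Definition mx_prod A B : 'M[{poly R}]_n := map_mx evl A *m map_mx evr B.
Definition mx_lprod A B i : 'M[R]_n := map_mx (coefp i) (mx_prod A B).

Let lift : {rmorphism {poly R} -> T} := map_poly evr.

Hypothesis fuse_evlE : forall p, fuse (evl p) = (evl p)%:P.
Hypothesis fuse_evrE : forall p, fuse (evr p) = lift (evl p).
Hypothesis addmu_evrE : forall p, addmu (evr p) = lift (evr p).

Lemma mx_prodE A B r s : mx_prod A B r s = \sum_t evl (A r t) * evr (B t s).
Proof. by rewrite mxE; apply: eq_bigr => t _; rewrite !mxE. Qed.

Lemma mx_lprodE A B i r s : mx_lprod A B i r s = (mx_prod A B r s)`_i.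
Proof. by rewrite mxE. Qed.

Lemma mx_lprodA A B D i j :
  mx_lprod A (mx_lprod B D j) i =
  \sum_(l < i.+1) mx_lprod (mx_lprod A B l) D (i - l + j) *+ 'C(i - l + j, j).
Proof.
pose G := map_mx polyC (map_mx evl A)
          *m (map_mx lift (map_mx evl B) *m map_mx lift (map_mx evr D)).
have G1 : G = map_mx polyC (map_mx evl A) *m map_mx lift (mx_prod B D).
  by rewrite /G -map_mxM.
have G2 : G = map_mx fuse (mx_prod A B) *m map_mx addmu (map_mx evr D).
  rewrite /G /mx_prod map_mxM mulmxA.
  by congr (_ *m _ *m _); apply/matrixP => r s;
    rewrite [LHS]mxE [RHS]mxE ?[in LHS]mxE ?[in RHS]mxE.
apply/matrixP => r s; transitivity ((G r s)`_j`_i).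
  rewrite G1 mx_lprodE mx_prodE mxE !coef_sum; apply: eq_bigr => t _.
  by rewrite mx_lprodE ![map_mx _ _ _ _]mxE coefCM coef_map.
rewrite G2 summxE mxE !coef_sum.
transitivity (\sum_t \sum_(l < i.+1) (evl (mx_prod A B r t)`_l
    * evr (D t s))`_(i - l + j) *+ 'C(i - l + j, j)).
  by apply: eq_bigr => t _; rewrite ![map_mx _ _ _ _]mxE coef_fuse.
rewrite exchange_big; apply: eq_bigr => l _.
rewrite sumrMnl mulmxnE mx_lprodE mx_prodE coef_sum; congr (_ *+ _).
by apply: eq_bigr => t _; rewrite mx_lprodE.
Qed.

End TwoStepProduct.

Section CendProduct.
Variables (k : fieldType) (n : nat).

Local Notation R := {poly {poly k}}.

(* k[∂, x][λ] is {poly R}. *)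
Definition cend_iota : {rmorphism k -> {poly R}} := polyC \o (polyC \o polyC).
Local Notation lambda := ('X : {poly R}).
Local Notation dd := ('X%:P%:P : {poly R}).
Local Notation xx := ('X%:P : {poly R}).

Definition evall : {rmorphism R -> {poly R}} := eval2 cend_iota (- lambda) xx.
Definition evalr : {rmorphism R -> {poly R}} :=
  eval2 cend_iota (dd + lambda) (xx + lambda).

(* A(-λ, x) B(∂ + λ, x + λ) *)
Definition cend_prod (A B : cend k n) : 'M[{poly R}]_n :=
  map_mx evall A *m map_mx evalr B.

Definition cend_lprod (A B : cend k n) (i : nat) : cend k n :=
  map_mx (coefp i) (cend_prod A B).

Lemma cend_lprodE A B i r s : cend_lprod A B i r s = (cend_prod A B r s)`_i.
Proof. by rewrite mxE. Qed.

Lemma eval2C (T : comNzRingType) (f : {rmorphism k -> T}) u v p :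
  eval2 f u v p%:P = (map_poly f p).[u].
Proof. by rewrite /eval2 /= map_polyC /= !horner_evalE hornerC. Qed.

Lemma eval2CC (T : comNzRingType) (f : {rmorphism k -> T}) u v c :
  eval2 f u v c%:P%:P = f c.
Proof. by rewrite eval2C map_polyC hornerC. Qed.

Lemma eval2CX (T : comNzRingType) (f : {rmorphism k -> T}) u v :
  eval2 f u v 'X%:P = u.
Proof. by rewrite eval2C map_polyX hornerX. Qed.

Lemma eval2X (T : comNzRingType) (f : {rmorphism k -> T}) u v :
  eval2 f u v 'X = v.
Proof. by rewrite /eval2 /= map_polyX horner_evalE hornerX. Qed.

Lemma cend_prodDl A A' B : cend_prod (A + A') B = cend_prod A B + cend_prod A' B.
Proof. by rewrite /cend_prod map_mxD mulmxDl. Qed.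

Lemma cend_prodDr A B B' : cend_prod A (B + B') = cend_prod A B + cend_prod A B'.
Proof. by rewrite /cend_prod map_mxD mulmxDr. Qed.

Lemma cend_prodZl p A B :
  cend_prod (p *: A) B = (map_poly cend_iota p).[- lambda] *: cend_prod A B.
Proof.
by rewrite /cend_prod [p *: A]/(cend_scale p A) map_mxZ scalemxAl -(eval2C _ _ xx).
Qed.

Lemma cend_prodZr p A B :
  cend_prod A (p *: B) = (map_poly cend_iota p).[dd + lambda] *: cend_prod A B.
Proof.
by rewrite /cend_prod [p *: B]/(cend_scale p B) map_mxZ scalemxAr -(eval2C _ _ (xx + lambda)).
Qed.

Let entryD (V : nmodType) (A B : 'M[V]_n) r s : (A + B) r s = A r s + B r s.
Proof. by rewrite mxE. Qed.

Let entryZ (V : pzRingType) (c : V) (A : 'M[V]_n) r s : (c *: A) r s = c * A r s.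
Proof. by rewrite mxE. Qed.

Let cend_entryD (A B : cend k n) r s : (A + B) r s = A r s + B r s.
Proof. exact: entryD. Qed.

Let cend_entryZ p (A : cend k n) r s : (p *: A) r s = p%:P * A r s.
Proof. exact: entryZ. Qed.

Let cend_entryN (A : cend k n) r s : (- A) r s = - A r s.
Proof. by rewrite [LHS]mxE. Qed.

Let cend_entry0 r s : (0 : cend k n) r s = 0.
Proof. by rewrite mxE. Qed.

Lemma cend_lprod_sesquilinear : sesquilinear cend_lprod.
Proof.
split.
- move=> A B; exists (\max_r \max_s size (cend_prod A B r s)) => i hi.
  apply/matrixP => r s; rewrite cend_lprodE [RHS]mxE; apply: nth_default.
  apply: leq_trans hi.
  pose F r' := \max_s' size (cend_prod A B r' s').
  apply: leq_trans (leq_bigmax (F := F) r).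
  exact: (leq_bigmax (F := fun s' => size (cend_prod A B r s')) s).
- move=> c A A' B i; apply/matrixP => r s.
  rewrite cend_lprodE cend_prodDl cend_prodZl map_polyC hornerC entryD coefD.
  rewrite [RHS]cend_entryD; congr (_ + _); last by rewrite cend_lprodE.
  by rewrite entryZ coefCM [RHS]cend_entryZ cend_lprodE.
- move=> c A B B' i; apply/matrixP => r s.
  rewrite cend_lprodE cend_prodDr cend_prodZr map_polyC hornerC entryD coefD.
  rewrite [RHS]cend_entryD; congr (_ + _); last by rewrite cend_lprodE.
  by rewrite entryZ coefCM [RHS]cend_entryZ cend_lprodE.
- move=> A B i; apply/matrixP => r s.
  rewrite cend_lprodE cend_prodZl map_polyX hornerX entryZ.
  rewrite mulNr coefN coefXM.
  by rewrite cend_entryN; case: i => [|i] /=; rewrite ?cend_entry0 ?cend_lprodE.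
- move=> A B i; apply/matrixP => r s.
  rewrite cend_lprodE cend_prodZr map_polyX hornerX entryZ mulrDl coefD coefCM.
  rewrite coefXM cend_entryD cend_entryZ cend_lprodE.
  by case: i => [|i] /=; rewrite ?cend_entry0 ?cend_lprodE.
Qed.


Let evallCC c : evall c%:P%:P = c%:P%:P%:P. Proof. exact: eval2CC. Qed.
Let evallCX : evall 'X%:P = - lambda. Proof. exact: eval2CX. Qed.
Let evallX : evall 'X = xx. Proof. exact: eval2X. Qed.
Let evalrCC c : evalr c%:P%:P = c%:P%:P%:P. Proof. exact: eval2CC. Qed.
Let evalrCX : evalr 'X%:P = dd + lambda. Proof. exact: eval2CX. Qed.
Let evalrX : evalr 'X = xx + lambda. Proof. exact: eval2X. Qed.

Lemma cend_lprodA A B D i j :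
  nested cend_lprod cend_lprod A B D i j
  = shifted cend_lprod cend_lprod A B D i j.
Proof.
have liftC p : map_poly evalr p%:P = (evalr p)%:P by exact: map_polyC.
have liftX : map_poly evalr 'X = 'X by exact: map_polyX.
apply: mx_lprodA.
- exact: (fuse_evl evallCC evallCX evallX (@addmuC _) (fuseC _) (fuseX _)).
- exact: (fuse_evr evallCC evallCX evallX evalrCC evalrCX evalrX
                   (@addmuC _) (addmuX _) (fuseC _) (fuseX _) liftC liftX).
- exact: (addmu_evr evalrCC evalrCX evalrX (@addmuC _) (addmuX _) liftC liftX).
Qed.

HB.instance Definition _ := isConfAlg.Build k (cend k n)
  cend_lprod_sesquilinear cend_lprodA.

(* Q has entries in k[x], whose variable becomes the outer one of {poly {poly k}}. *)
Definition xmx (Q : 'M[{poly k}]_n) : 'M[R]_n := map_mx (map_poly polyC) Q.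

(* Q M_n(k[∂, x]) *)
Definition in_cendQ (Q : 'M[{poly k}]_n) : {pred cend k n} :=
  fun A => `[< exists B : 'M[R]_n, A = xmx Q *m B >].

Lemma in_cendQ_closed Q : subsemimod_closed (in_cendQ Q).
Proof.
split=> [|p A /asboolP[B ->]]; last first.
  by apply/asboolP; exists (p%:P *: B); rewrite -scalemxAr.
split=> [|A B /asboolP[A' ->] /asboolP[B' ->]]; apply/asboolP.
  by exists 0; rewrite mulmx0.
by exists (A' + B'); rewrite mulmxDr.
Qed.

Lemma evall_xmx Q : map_mx evall (xmx Q) = map_mx polyC (xmx Q).
Proof.
apply/matrixP => r s; rewrite !mxE.
elim/poly_ind: (Q r s) => [|p c IHp]; first by rewrite !rmorph0.
rewrite rmorphD rmorphM /= map_polyX map_polyC /=.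
by rewrite !rmorphD !rmorphM /= IHp evallX evallCC.
Qed.

Lemma in_cendQ_lprod Q (A B : cend k n) i :
  A \in in_cendQ Q -> cend_lprod A B i \in in_cendQ Q.
Proof.
move=> /asboolP[A' ->]; apply/asboolP; exists (cend_lprod A' B i).
rewrite /cend_lprod /cend_prod map_mxM evall_xmx -mulmxA.
apply/matrixP => r s; rewrite mxE [RHS]mxE mxE /= coef_sum.
by apply: eq_bigr => t _; rewrite mxE coefCM [X in _ = _ * X]mxE.
Qed.

End CendProduct.

Record cendQ (k : fieldType) (n : nat) (Q : 'M[{poly k}]_n) :=
  CendQ { cendQ_val :> cend k n; cendQ_valP : cendQ_val \in in_cendQ Q }.

Section CendQ.
Variables (k : fieldType) (n : nat) (Q : 'M[{poly k}]_n).

HB.instance Definition _ := [isSub for @cendQ_val k n Q].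
HB.instance Definition _ := [Choice of cendQ Q by <:].
HB.instance Definition _ := GRing.SubChoice_isSubLmodule.Build {poly k}
  (cend k n) (in_cendQ Q) (cendQ Q) (in_cendQ_closed Q).

Definition cendQ_lprod (A B : cendQ Q) (i : nat) : cendQ Q :=
  CendQ (in_cendQ_lprod B i (cendQ_valP A)).

Lemma cendQ_lprod_sesquilinear : sesquilinear cendQ_lprod.
Proof.
have h := @cend_lprod_sesquilinear k n.
split.
- move=> A B; have [N hN] := sesq_lpoly h (val A) (val B).
  by exists N => i Ni; apply: val_inj; rewrite /= hN ?raddf0.
- move=> c A A' B i; apply: val_inj.
  rewrite linearP; apply: etrans (sesq_linl h _ _ _ _ _).
  by congr (cend_lprod _ _ _); exact: (linearP val).
- move=> c A B B' i; apply: val_inj.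
  rewrite linearP; apply: etrans (sesq_linr h _ _ _ _ _).
  by congr (cend_lprod _ _ _); exact: (linearP val).
- move=> A B i; apply: val_inj; rewrite raddfN.
  transitivity (cend_lprod ('X *: val A) (val B) i).
    by congr (cend_lprod _ _ _); exact: (linearZ_LR val).
  rewrite (sesq_dl h); congr (- _).
  by case: i => [|i] //; exact: esym (raddf0 val).
- move=> A B i; apply: val_inj; rewrite raddfD.
  transitivity (cend_lprod (val A) ('X *: val B) i).
    by congr (cend_lprod _ _ _); exact: (linearZ_LR val).
  rewrite (sesq_dr h); congr (_ + _).
  by case: i => [|i] //; exact: esym (raddf0 val).
Qed.

Lemma cendQ_lprodA A B D i j :
  nested cendQ_lprod cendQ_lprod A B D i j
  = shifted cendQ_lprod cendQ_lprod A B D i j.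
Proof.
apply: val_inj; rewrite /shifted raddf_sum.
apply: etrans (cend_lprodA _ _ _ _ _) _.
by apply: eq_bigr => l _; rewrite raddfMn.
Qed.

HB.instance Definition _ := isConfAlg.Build k (cendQ Q)
  cendQ_lprod_sesquilinear cendQ_lprodA.

End CendQ.

(* diag(1, ..., 1, x) *)
Definition diag1x (k : fieldType) (n : nat) : 'M[{poly k}]_n :=
  diag_mx (\row_(i < n) if i.+1 == n then 'X else 1).

(* Main.v *)
Require Import Defs.
From mathcomp Require Import all_boot all_order all_algebra.
From mathcomp Require Import boolp ring_quotient generic_quotient ssrAC.
From HB Require Import structures.

Import GRing.Theory.
Local Open Scope ring_scope.

Set Implicit Arguments.
Unset Strict Implicit.
Unset Printing Implicit Defensive.

(** A 2-cocycle phi of C with values in M is the same thing as a square-zero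
    extension E of C by M: the H-module C (+) M with the product
      (a, m)_λ (b, n) = (a_λ b, a_λ n + m_λ b + phi_λ(a, b)),
    the cocycle identity being the associativity of E.  A homomorphic section
    a |-> (a, t a) of the projection E -> C says precisely that phi = d1 (- t),
    so it is enough that every surjection of conformal algebras onto C with a
    square-zero kernel splits.

    Let q = (1, ..., 1, x) be the diagonal of Q, o and z the first and the last
    index, u_i = q_i E_io, v_j = E_oj and e = u_o = v_o = E_oo.  Then
      e_λ v_j = v_j,   u_i_λ e = u_i,   v_j_λ u_i = 0 for i <> j,
      v_i_λ u_i = e for i <> z,   v_z_λ u_z = X + λ e,  where X = x E_oo.
    Call such a family a frame.  From these relations alone the elements
    u_i X^r v_j multiply by a universal formula [frame_eltM]; in C they are the
    matrices q_i x^r E_ij, which span C over H.  Hence a frame of E lying over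
    the standard frame of C defines a homomorphism C -> E that is a section
    [square_zero_splits], and everything rests on lifting frames along
    square-zero surjections [frame_lift].

    Lifting first treats e [idempotent_lift], the only place where one has to
    integrate with respect to λ.  Then the v_j and u_i are made invariant under
    e, and their products are corrected by subtracting kernel elements: columns
    against the rows j <> z, then rows against the columns i <> z, as in
    Gaussian elimination with the pivots v_i_λ u_i = e.  For the product
    v_z_λ u_z this would mean dividing its error by X.  But only the shape
    X + λ e is required, so X itself may change, and up to such a change the
    error is the coboundary of its own value at λ = - X, which is a multiple of
    X since the error vanishes at λ = 0 [corner_lift].

    As k is infinite, a polynomial in λ is determined by its values at scalars,
    and the identities above are proved at scalars, where associativity reads
    a_l (b_m c) = (a_l b)_(l + m) c.  Besides scalars, two operators are
    substituted for λ: the opposite of the derivation, and the opposite of the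
    left multiplication by X.  Let L be the left multiplication by e at λ = l.
    Both operators satisfy L T = (T - l) L, the second one on the kernel only.
    Hence L turns the value of p at T into the value of L p at T - l, i.e. into
    the value at T of the polynomial q such that L (p(λ)) = q(λ + l)
    [subst_intertwine]. *)

(** * Maps that are linear over the scalars *)

Section KLinear.
Variables (k : fieldType) (V W : lmodType {poly k}).

(** The actions of conformal algebras do not commute with the derivation, so
    that they are linear over k only. *)
Definition klinear (f : V -> W) :=
  forall (c : k) a b, f (c%:P *: a + b) = c%:P *: f a + f b.

Variable f : V -> W.
Hypothesis hf : klinear f.

Lemma klinearD : {morph f : a b / a + b}.
Proof. by move=> a b; have := hf 1 a b; rewrite !scale1r. Qed.

Lemma klinear0 : f 0 = 0.
Proof. by apply: (addIr (f 0)); rewrite -klinearD !add0r. Qed.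

Lemma klinearZ c a : f (c%:P *: a) = c%:P *: f a.
Proof. by have := hf c a 0; rewrite klinear0 !addr0. Qed.

Lemma klinearN : {morph f : a / - a}.
Proof.
by move=> a; apply: (addIr (f a)); rewrite -klinearD !addNr klinear0.
Qed.

Lemma klinearB : {morph f : a b / a - b}.
Proof. by move=> a b; rewrite klinearD klinearN. Qed.

Lemma klinear_sum I (r : seq I) (P : pred I) (F : I -> V) :
  f (\sum_(i <- r | P i) F i) = \sum_(i <- r | P i) f (F i).
Proof. exact: (big_morph f klinearD klinear0). Qed.

End KLinear.

Section Sesquilinear.
Variables (k : fieldType) (U V W : lmodType {poly k}) (f : U -> V -> nat -> W).
Hypothesis hf : sesquilinear f.

Lemma sesq_klinearl b i : klinear (fun a => f a b i).
Proof. by move=> c a a'; exact: (sesq_linl hf). Qed.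

Lemma sesq_klinearr a i : klinear (fun b => f a b i).
Proof. by move=> c b b'; exact: (sesq_linr hf). Qed.

End Sesquilinear.

(** * Substituting scalars and operators for λ *)

Section Substitution.
Variables (k : fieldType) (W : lmodType {poly k}).
Implicit Types (p q : nat -> W) (T : W -> W).

Lemma klinear_iter T i : klinear T -> klinear (iter i T).
Proof. by move=> hT; elim: i => [|i IHi] c a b //=; rewrite IHi hT. Qed.

Lemma klinear_scale (h : {poly k}) : klinear (fun w : W => h *: w).
Proof. by move=> c a b; rewrite scalerDr !scalerA mulrC. Qed.

Definition degree_bound p : nat :=
  if pselect (lpoly p) is left h then sval (cid h) else 0.

(** The value of p(λ) at λ = T, with the powers of T on the left. *)
Definition subst T p : W := \sum_(i < degree_bound p) iter i T (p i).

Definition ev (l : k) p : W := subst (fun w => l%:P *: w) p.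

Lemma degree_boundP p i : lpoly p -> (degree_bound p <= i)%N -> p i = 0.
Proof.
by rewrite /degree_bound; case: pselect => // h _; case: (cid h) => N /= hN /hN.
Qed.

Lemma sum_vanishing (F : nat -> W) M N :
  (forall i, (M <= i)%N -> F i = 0) -> (forall i, (N <= i)%N -> F i = 0) ->
  \sum_(i < M) F i = \sum_(i < N) F i.
Proof.
wlog MN : M N / (M <= N)%N.
  by move=> hw hM hN; case/orP: (leq_total M N) => ?; [|symmetry]; apply: hw.
move=> hM _; rewrite (big_ord_widen _ F MN) big_mkcond; apply: eq_bigr => i _.
by case: ltnP => // /hM.
Qed.

Lemma sum_offset (F : nat -> W) (p N : nat) :
  \sum_(i < N | (p <= i)%N) F (i - p)%N = \sum_(r < N - p) F r.
Proof.
rewrite -(big_mkord (fun i => p <= i)%N (fun i => F (i - p)%N)).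
rewrite -(big_nat_widenl p 0 N xpredT (fun i => F (i - p)%N)) //.
rewrite -{1}[p]add0n big_addn big_mkord.
by apply: eq_bigr => r _; rewrite addnK.
Qed.

Lemma lpoly_bound2 p q : lpoly p -> lpoly q ->
  exists2 N, forall i, (N <= i)%N -> p i = 0 & forall i, (N <= i)%N -> q i = 0.
Proof.
move=> [M hM] [N hN]; exists (M + N)%N => i hi.
  by apply: hM; apply: leq_trans hi; apply: leq_addr.
by apply: hN; apply: leq_trans hi; apply: leq_addl.
Qed.

Lemma substE T p N : klinear T -> (forall i, (N <= i)%N -> p i = 0) ->
  subst T p = \sum_(i < N) iter i T (p i).
Proof.
move=> hT hN; apply: (sum_vanishing (F := fun i => iter i T (p i))) => i hi.
  by rewrite degree_boundP ?(klinear0 (klinear_iter _ hT)) //; exists N.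
by rewrite hN // (klinear0 (klinear_iter _ hT)).
Qed.

Lemma substP T c p q : klinear T -> lpoly p -> lpoly q ->
  subst T (fun i => c%:P *: p i + q i) = c%:P *: subst T p + subst T q.
Proof.
move=> hT lpp lpq; have [N hp hq] := lpoly_bound2 lpp lpq.
rewrite (substE hT hp) (substE hT hq) (@substE _ _ N hT); last first.
  by move=> i hi; rewrite hp ?hq // scaler0 addr0.
rewrite scaler_sumr -big_split; apply: eq_bigr => i _.
exact: klinear_iter.
Qed.

Lemma substD T p q : klinear T -> lpoly p -> lpoly q ->
  subst T (fun i => p i + q i) = subst T p + subst T q.
Proof.
move=> hT hp hq; rewrite -[subst T p]scale1r -[1]/((1 : k)%:P) -substP //.
by congr subst; apply/funext => i; rewrite scale1r.
Qed.

Lemma substB T p q : klinear T -> lpoly p -> lpoly q ->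
  subst T (fun i => p i - q i) = subst T p - subst T q.
Proof.
move=> hT hp hq; rewrite addrC -scaleN1r -[-1](polyCN (1 : k)) -substP //.
by congr subst; apply/funext => i; rewrite polyCN scaleN1r addrC.
Qed.

Lemma iter_scale (l : k) i w :
  iter i (fun w : W => l%:P *: w) w = (l ^+ i)%:P *: w.
Proof.
elim: i => [|i IHi] /=; first by rewrite scale1r.
by rewrite IHi scalerA -polyCM exprS.
Qed.

Lemma evE l p N : (forall i, (N <= i)%N -> p i = 0) ->
  ev l p = \sum_(i < N) (l ^+ i)%:P *: p i.
Proof.
move=> /(substE (klinear_scale l%:P)); rewrite /ev => ->.
by apply: eq_bigr => i _; rewrite iter_scale.
Qed.

Lemma ev0 p : lpoly p -> ev 0 p = p 0%N.
Proof.
move=> [N hN]; rewrite (@evE _ _ N.+1) => [|i /ltnW /hN //].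
rewrite big_ord_recl expr0 scale1r big1 ?addr0 // => i _.
by rewrite expr0n /= scale0r.
Qed.

Lemma evB l p q : lpoly p -> lpoly q ->
  ev l (fun i => p i - q i) = ev l p - ev l q.
Proof. exact: (substB (klinear_scale _)). Qed.

Lemma lpolyB p q : lpoly p -> lpoly q -> lpoly (fun i => p i - q i).
Proof.
move=> lpp lpq; have [N hp hq] := lpoly_bound2 lpp lpq; exists N => i hi.
by rewrite hp ?hq ?subrr.
Qed.

Definition constp (w : W) (i : nat) : W := if i is 0 then w else 0.

Lemma lpoly_constp w : lpoly (constp w).
Proof. by exists 1%N => -[]. Qed.

Lemma subst_constp T w : klinear T -> subst T (constp w) = w.
Proof. by move=> hT; rewrite (substE (N := 1) hT) ?big_ord1 // => -[]. Qed.

Lemma ev_constp l w : ev l (constp w) = w.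
Proof. exact: (subst_constp _ (klinear_scale _)). Qed.

End Substitution.

Lemma lpoly_klinear (k : fieldType) (V W : lmodType {poly k}) (f : V -> W) p :
  klinear f -> lpoly p -> lpoly (fun i => f (p i)).
Proof. by move=> hf [N hN]; exists N => i /hN ->; exact: klinear0. Qed.

Lemma ev_klinear (k : fieldType) (V W : lmodType {poly k}) (f : V -> W) l p :
  klinear f -> lpoly p -> f (ev l p) = ev l (fun i => f (p i)).
Proof.
move=> hf [N hN]; rewrite (evE _ hN) (klinear_sum hf) (@evE _ _ _ _ N).
  by apply: eq_bigr => i _; rewrite (klinearZ hf).
by move=> i /hN ->; exact: klinear0.
Qed.

Lemma evN (k : fieldType) (W : lmodType {poly k}) l (p : nat -> W) : lpoly p ->
  ev l (fun i => - p i) = - ev l p.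
Proof.
move=> hp; rewrite -(ev_klinear (f := -%R)) // => c a b.
by rewrite opprD scalerN.
Qed.

Section Uniqueness.
Variables (k : fieldType) (char_k : [pchar k] =i pred0) (W : lmodType {poly k}).
Implicit Types (p q : nat -> W).

(** By induction on the degree bound N + 1: the polynomial p(2l) - 2^N p(l)
    has no term of degree N, and its other coefficients are those of p, up to
    the nonzero factors 2^i - 2^N. *)
Lemma ev_eq0 p : lpoly p -> (forall l, ev l p = 0) -> forall i, p i = 0.
Proof.
have natr_inj m n : (m%:R == n%:R :> k) = (m == n).
  wlog mn : m n / (m <= n)%N.
    move=> hw; case/orP: (leq_total m n) => /hw //.
    by rewrite eq_sym => ->; rewrite eq_sym.
  rewrite eq_sym -subr_eq0 -natrB // (iffLR (GRing.pcharf0P k) char_k) subn_eq0.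
  by rewrite eqn_leq mn.
move=> [N hN] hp i; have [/hN //|iN] := leqP N i.
have {}hp l : \sum_(i < N) (l ^+ i)%:P *: p i = 0 by rewrite -evE.
elim: N p {hN} hp i iN => // N IHN p hp.
have hlt i : (i < N)%N -> p i = 0.
  move=> iN; pose c j := (2 ^ j)%:R - (2 ^ N)%:R : k.
  have h : (c i)%:P *: p i = 0.
    apply: (IHN (fun j => (c j)%:P *: p j)) => // l.
    have := hp (2%:R * l); rewrite big_ord_recr /= => h2.
    have := hp l; rewrite big_ord_recr /= => /(canRL (addKr _)).
    rewrite addr0 => h1; have := h2; rewrite exprMn polyCM -scalerA h1.
    move/eqP; rewrite scalerN subr_eq0 => /eqP h3.
    under eq_bigr => j _ do rewrite scalerA -polyCM mulrBr polyCB scalerBl.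
    rewrite sumrB; apply/eqP; rewrite subr_eq0; apply/eqP.
    rewrite scaler_sumr in h3.
    under eq_bigr => j _ do rewrite mulrC natrX -exprMn.
    by rewrite h3; apply: eq_bigr => j _; rewrite scalerA -polyCM natrX mulrC.
  have c0 : c i != 0 by rewrite subr_eq0 natr_inj eqn_exp2l // ltn_eqF.
  rewrite -[p i]scale1r -[1]/((1 : k)%:P) -(mulVf c0) polyCM -scalerA h.
  exact: scaler0.
move=> i; rewrite ltnS leq_eqVlt => /predU1P[->|/hlt //].
have := hp 1; rewrite big_ord_recr /= expr1n scale1r big1 ?add0r // => j _.
by rewrite hlt // scaler0.
Qed.

Lemma ev_inj p q : lpoly p -> lpoly q -> (forall l, ev l p = ev l q) -> p =1 q.
Proof.
move=> hp hq h i; apply/eqP; rewrite -subr_eq0; apply/eqP.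
apply: (ev_eq0 (p := fun i => p i - q i)) i => [|l]; first exact: lpolyB.
by rewrite evB // h subrr.
Qed.

End Uniqueness.

Section Taylor.
Variables (k : fieldType) (W : lmodType {poly k}).
Implicit Types (p q : nat -> W) (T : W -> W) (l m : k).

(** The polynomial q(l + μ) in μ. *)
Definition taylor l q (i : nat) : W :=
  \sum_(n < degree_bound q) (l ^+ (n - i) *+ 'C(n, i))%:P *: q n.

Lemma lpoly_taylor l q : lpoly (taylor l q).
Proof.
exists (degree_bound q) => i hi; rewrite /taylor big1 // => n _.
by rewrite bin_small ?scale0r // (leq_trans _ hi).
Qed.

Lemma taylorE l q N i : (forall i, (N <= i)%N -> q i = 0) ->
  taylor l q i = \sum_(n < N) (l ^+ (n - i) *+ 'C(n, i))%:P *: q n.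
Proof.
move=> hN; apply: (sum_vanishing
    (F := fun n => (l ^+ (n - i) *+ 'C(n, i))%:P *: q n)) => j hj.
  by rewrite degree_boundP ?scaler0 //; exists N.
by rewrite hN ?scaler0.
Qed.

Lemma taylorB l p q i : lpoly p -> lpoly q ->
  taylor l (fun j => p j - q j) i = taylor l p i - taylor l q i.
Proof.
move=> lpp lpq; have [N hp hq] := lpoly_bound2 lpp lpq.
rewrite (taylorE _ _ hp) (taylorE _ _ hq) (@taylorE _ _ N).
  by rewrite -sumrB; apply: eq_bigr => n _; rewrite scalerBr.
by move=> j hj; rewrite hp ?hq ?subrr.
Qed.

Lemma taylor_constp l w i : taylor l (constp w) i = constp w i.
Proof.
rewrite (@taylorE _ _ 1) => [|[]//]; rewrite big_ord1 /=.
by case: i => [|i]; rewrite ?scale1r // bin_small ?scale0r.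
Qed.

Lemma iter_binomial T l n w : klinear T ->
  iter n T w = \sum_(i < n.+1)
    (l ^+ (n - i) *+ 'C(n, i))%:P *: iter i (fun w => T w - l%:P *: w) w.
Proof.
move=> hT; set D := fun w => _ - _.
have TE x : T x = D x + l%:P *: x by rewrite subrK.
elim: n => [|n IHn]; first by rewrite big_ord1 scale1r.
rewrite iterS IHn (klinear_sum hT).
under eq_bigr => i _.
  rewrite (klinearZ hT) TE scalerDr -iterS scalerA -polyCM; over.
rewrite big_split /= big_ord_recr [X in _ + X]big_ord_recl /= subnn binn.
rewrite [RHS]big_ord_recl [X in _ = _ + X]big_ord_recr /= subnn binn !subn0.
rewrite !bin0 mulr1n expr0 -exprSr addrCA -!addrA; congr (_ + _).
rewrite addrCA [RHS]addrC; congr (_ + _); rewrite -big_split /=.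
apply: eq_bigr => i _; rewrite /bump /= !add1n -scalerDl -polyCD subSS binS.
congr (_%:P *: _); rewrite mulrnAl -exprSr subnSK //.
by rewrite mulrnDr addrC.
Qed.

(** The left-hand side is the value of q(l + μ) at μ = T - l. *)
Lemma subst_taylor T l q N : klinear T -> (forall i, (N <= i)%N -> q i = 0) ->
  \sum_(i < N) iter i (fun w => T w - l%:P *: w) (taylor l q i) = subst T q.
Proof.
move=> hT hN; rewrite (substE hT hN); set D := fun w => _ - _.
have hD : klinear D.
  by move=> c a b; rewrite /D hT klinear_scale opprD scalerBr addrACA.
have hDi i := klinear_iter i hD.
under eq_bigr => i _ do rewrite (taylorE _ _ hN) (klinear_sum (hDi _)).
rewrite exchange_big; apply: eq_bigr => n _.
rewrite (iter_binomial l _ _ hT) /=.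
rewrite (big_ord_widen N
  (fun i => (l ^+ (n - i) *+ 'C(n, i))%:P *: iter i D (q n))) //.
rewrite [RHS]big_mkcond; apply: eq_bigr => i _; rewrite (klinearZ (hDi _)).
by case: ltnP => // /bin_small ->; rewrite scale0r.
Qed.

Lemma ev_taylor l m q : lpoly q -> ev m (taylor l q) = ev (l + m) q.
Proof.
move=> [N hN]; rewrite [RHS]/ev -(subst_taylor l (klinear_scale _) hN).
rewrite (@evE _ _ _ _ N); last first.
  move=> i hi; rewrite (taylorE _ _ hN) big1 // => n _.
  by rewrite bin_small ?scale0r // (leq_trans _ hi).
apply: eq_bigr => i _; rewrite -iter_scale; apply: eq_iter => w.
by rewrite -scalerBl -polyCB addrC addKr.
Qed.

Lemma taylor0 l q : lpoly q -> taylor l q 0 = ev l q.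
Proof.
move=> hq; rewrite -[l in RHS]addr0 -ev_taylor // ev0 //.
exact: lpoly_taylor.
Qed.

Lemma taylor_uniq l p q : [pchar k] =i pred0 -> lpoly p -> lpoly q ->
  (forall m, ev m p = ev (l + m) q) -> p =1 taylor l q.
Proof.
move=> char_k hp hq h; apply: (ev_inj char_k) => // [|m].
  exact: lpoly_taylor.
by rewrite ev_taylor.
Qed.

(** The hypothesis combines L T = (T - l) L and L (p(μ)) = q(l + μ); it is
    required on the coefficients of p only, because L T = (T - l) L may fail
    outside a submodule that contains them. *)
Lemma subst_intertwine (L T : W -> W) l p q : klinear L -> klinear T ->
  lpoly p -> lpoly q ->
  (forall i, L (iter i T (p i))
             = iter i (fun w => T w - l%:P *: w) (taylor l q i)) ->
  L (subst T p) = subst T q.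
Proof.
move=> hL hT lpp lpq h; have [N hp hq] := lpoly_bound2 lpp lpq.
rewrite -(subst_taylor l hT hq) (substE hT hp) (klinear_sum hL).
by apply: eq_bigr => i _; rewrite h.
Qed.

(** Polynomials with L (p(μ)) = p(l + μ) - p(l), i.e. 1-cocycles of the additive
    group acting by L: the value of p at T is a primitive of - p. *)
Lemma subst_primitive (L T : W -> W) l p : klinear L -> klinear T -> lpoly p ->
  (forall i, L (iter i T (p i))
             = iter i (fun w => T w - l%:P *: w) (L (p i))) ->
  (forall i, L (p i) = taylor l p i - constp (ev l p) i) ->
  L (subst T p) = subst T p - ev l p.
Proof.
move=> hL hT lpp hLT hLp; have lpc := lpoly_constp (ev l p).
rewrite -[ev l p in RHS](subst_constp _ hT) -substB //.
apply: (subst_intertwine (l := l)) => // [|i]; first exact: lpolyB.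
by rewrite hLT hLp taylorB // taylor_constp.
Qed.

End Taylor.

(** * Values of the λ-product at scalars and at - ∂ *)

Section ProductDefinitions.
Variables (k : fieldType) (C : confAlgType k).

Definition prodl (l : k) (a b : C) : C := ev l (lprod a b).

Definition dopp (a : C) : C := - 'X *: a.

(** The product at λ = - ∂.  If e *_[l] e = e for all l, then e *_d b is fixed
    by all e *_[l] _, see [prodl_prodd], just as b *_[0] e is fixed by all
    _ *_[l] e. *)
Definition prodd (a b : C) : C := subst dopp (lprod a b).

Lemma lpoly_lprod (a b : C) : lpoly (lprod a b).
Proof. exact: (sesq_lpoly lprod_sesquilinear). Qed.

End ProductDefinitions.

Local Notation "a *_[ l ] b" := (prodl l a b)
  (at level 40, l at level 200, left associativity).
Local Notation "a *_d b" := (prodd a b) (at level 40, left associativity).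
#[local] Hint Extern 0 (lpoly _) => exact: lpoly_lprod : core.
#[local] Hint Extern 0 (lpoly _) => exact: lpoly_constp : core.

Section ConformalProduct.
Variables (k : fieldType) (C : confAlgType k).
Implicit Types (a b c : C) (l m : k).

Local Notation lprod := (@lprod k C).

Lemma lprod_linl b i : klinear (fun a => lprod a b i).
Proof. exact: (sesq_klinearl lprod_sesquilinear). Qed.

Lemma lprod_linr a i : klinear (fun b => lprod a b i).
Proof. exact: (sesq_klinearr lprod_sesquilinear). Qed.

Lemma prodl_linl l b : klinear (fun a => a *_[l] b).
Proof.
move=> c a a'; rewrite /prodl -[RHS](substP _ (klinear_scale _)) //.
by congr (ev l _); apply/funext => i; exact: lprod_linl.
Qed.

Lemma prodl_linr l a : klinear (prodl l a).
Proof.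
move=> c b b'; rewrite /prodl -[RHS](substP _ (klinear_scale _)) //.
by congr (ev l _); apply/funext => i; exact: lprod_linr.
Qed.

Lemma prodlDl l a a' b : (a + a') *_[l] b = a *_[l] b + a' *_[l] b.
Proof. exact: (klinearD (prodl_linl l b)). Qed.
Lemma prodlDr l a b b' : a *_[l] (b + b') = a *_[l] b + a *_[l] b'.
Proof. exact: (klinearD (prodl_linr l a)). Qed.
Lemma prodlBl l a a' b : (a - a') *_[l] b = a *_[l] b - a' *_[l] b.
Proof. exact: (klinearB (prodl_linl l b)). Qed.
Lemma prodlBr l a b b' : a *_[l] (b - b') = a *_[l] b - a *_[l] b'.
Proof. exact: (klinearB (prodl_linr l a)). Qed.
Lemma prodlNl l a b : (- a) *_[l] b = - (a *_[l] b).
Proof. exact: (klinearN (prodl_linl l b)). Qed.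
Lemma prodlNr l a b : a *_[l] (- b) = - (a *_[l] b).
Proof. exact: (klinearN (prodl_linr l a)). Qed.
Lemma prodl0l l b : 0 *_[l] b = 0.
Proof. exact: (klinear0 (prodl_linl l b)). Qed.
Lemma prodl0r l a : a *_[l] 0 = 0.
Proof. exact: (klinear0 (prodl_linr l a)). Qed.
Lemma prodlZl l (x : k) a b : (x%:P *: a) *_[l] b = x%:P *: (a *_[l] b).
Proof. exact: (klinearZ (prodl_linl l b)). Qed.
Lemma prodlZr l (x : k) a b : a *_[l] (x%:P *: b) = x%:P *: (a *_[l] b).
Proof. exact: (klinearZ (prodl_linr l a)). Qed.
Lemma prodl_suml l I (r : seq I) (P : pred I) (F : I -> C) b :
  (\sum_(i <- r | P i) F i) *_[l] b = \sum_(i <- r | P i) (F i *_[l] b).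
Proof. exact: (klinear_sum (prodl_linl l b)). Qed.
Lemma prodl_sumr l I (r : seq I) (P : pred I) (F : I -> C) a :
  a *_[l] (\sum_(i <- r | P i) F i) = \sum_(i <- r | P i) (a *_[l] F i).
Proof. exact: (klinear_sum (prodl_linr l a)). Qed.

Lemma lpoly_mul_lambda (p : nat -> C) : lpoly p -> lpoly (mul_lambda p).
Proof. by move=> [N hN]; exists N.+1 => -[|i] //= /hN. Qed.

Lemma ev_mul_lambda l (p : nat -> C) : lpoly p ->
  ev l (mul_lambda p) = l%:P *: ev l p.
Proof.
move=> [N hN]; rewrite (evE _ hN) (@evE _ _ _ _ N.+1) => [|[|i] //= /hN //].
rewrite big_ord_recl /= scaler0 add0r scaler_sumr; apply: eq_bigr => i _.
by rewrite scalerA -polyCM exprS.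
Qed.

Lemma prodl_dl l a b : ('X *: a) *_[l] b = - (l%:P *: (a *_[l] b)).
Proof.
rewrite /prodl -ev_mul_lambda // -evN; last exact: lpoly_mul_lambda.
by congr (ev l _); apply/funext => i; rewrite (sesq_dl lprod_sesquilinear).
Qed.

Lemma prodl_dr l a b :
  a *_[l] ('X *: b) = 'X *: (a *_[l] b) + l%:P *: (a *_[l] b).
Proof.
rewrite /prodl -ev_mul_lambda // (ev_klinear l (klinear_scale 'X)) //.
rewrite /ev -(substD (klinear_scale _)).
- by congr subst; apply/funext => i; rewrite (sesq_dr lprod_sesquilinear).
- exact: lpoly_klinear (klinear_scale _) _.
- exact: lpoly_mul_lambda.
Qed.

(** Associativity, as an identity between polynomials in μ whose left-hand side
    is a_l (b_μ c): with λ replaced by a scalar, the binomial coefficients are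
    those of the Taylor expansion of (a_l b)_(l + μ) c. *)
Lemma prodl_coef l a b c j :
  a *_[l] lprod b c j = taylor l (lprod (a *_[l] b) c) j.
Proof.
have [P hP] := lpoly_lprod a b.
have linl n : klinear (fun w => lprod w c n) by exact: lprod_linl.
have /choice[B hB] : forall p, exists N, forall i, (N <= i)%N ->
    lprod (lprod a b p) c i = 0 by move=> p; exact: lpoly_lprod.
pose D := \max_(p < P) B p.
have hD p i : (D <= i)%N -> lprod (lprod a b p) c i = 0.
  have [/hP ->|pP] := leqP P p; first by rewrite (klinear0 (linl i)).
  move=> Di; apply: hB; apply: leq_trans Di.
  exact: (leq_bigmax (F := fun p : 'I_P => B p) (Ordinal pP)).
have hab n : lprod (a *_[l] b) c n
    = \sum_(p < P) (l ^+ p)%:P *: lprod (lprod a b p) c n.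
  rewrite /prodl (evE _ hP) (klinear_sum (linl n)).
  by apply: eq_bigr => p _; rewrite (klinearZ (linl n)).
have habD n : (D + j <= n)%N -> lprod (a *_[l] b) c n = 0.
  move=> hn; rewrite hab big1 // => p _; rewrite hD ?scaler0 //.
  by apply: leq_trans hn; apply: leq_addr.
(* The term in λ^(p + r) μ^j of λ^p (λ + μ)^(r + j) (a_(p) b)_(r + j) c. *)
pose G p r := (l ^+ (p + r) *+ 'C(r + j, j))%:P
              *: lprod (lprod a b p) c (r + j)%N.
have hG p r : (D <= r)%N -> G p r = 0.
  by move=> Dr; rewrite /G hD ?scaler0 // (leq_trans Dr) // leq_addr.
transitivity (\sum_(p < P) \sum_(r < D) G p r); last first.
  rewrite (taylorE _ _ habD).
  under [RHS]eq_bigr => n _ do rewrite hab scaler_sumr.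
  rewrite [RHS]exchange_big; apply: eq_bigr => p _.
  rewrite [RHS](bigID (fun n : 'I__ => (j <= n)%N)).
  rewrite [X in _ = _ + X]big1 /=; last first.
    by move=> n; rewrite -ltnNge => /bin_small ->; rewrite scale0r.
  have -> : \sum_(r < D) G p r = \sum_(i < D + j | (j <= i)%N) G p (i - j)%N.
    by rewrite sum_offset addnK.
  rewrite addr0; apply: eq_bigr => n jn; rewrite /G subnK // scalerA -polyCM.
  by rewrite mulrnAl -exprD addnC.
have hl i : (P + D <= i)%N -> lprod a (lprod b c j) i = 0.
  move=> hi; have := lprodA a b c i j; rewrite /nested /shifted => ->.
  rewrite big1 // => p _; have [/hP ->|pP] := leqP P p.
    by rewrite (klinear0 (linl _)) mul0rn.
  rewrite hD ?mul0rn // (leq_trans _ (leq_addr _ _)) // leq_subRL; last first.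
    by rewrite -ltnS.
  by apply: leq_trans hi; rewrite leq_add2r ltnW.
rewrite /prodl (evE _ hl).
transitivity (\sum_(i < P + D) \sum_(p < P)
    if (p <= i)%N then G p (i - p)%N else 0).
  apply: eq_bigr => i _; have := lprodA a b c i j.
  rewrite /nested /shifted => ->; rewrite scaler_sumr.
  pose F p := if (p <= i)%N then G p (i - p)%N else 0.
  rewrite -/(F _) (@sum_vanishing _ _ F P i.+1) => [|p /hP h0|p]; first last.
  - by rewrite /F ltnNge; case: leqP.
  - by rewrite /F /G h0 (klinear0 (linl _)) scaler0 if_same.
  apply: eq_bigr => p _; rewrite /F -ltnS ltn_ord /G subnKC -1?ltnS //.
  by rewrite polyCMn -scalerMnl scalerMnr.
rewrite exchange_big; apply: eq_bigr => p _.
rewrite -big_mkcond sum_offset; apply: sum_vanishing => r hr; apply: hG => //.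
apply: leq_trans hr; rewrite leq_subRL; first by rewrite leq_add2r ltnW.
by rewrite (leq_trans (ltnW (ltn_ord p))) ?leq_addr.
Qed.

Lemma prodlA l m a b c : a *_[l] (b *_[m] c) = (a *_[l] b) *_[l + m] c.
Proof.
rewrite {2}/prodl (ev_klinear _ (prodl_linr l a)) // -[RHS]ev_taylor //.
by congr (ev m _); apply/funext => j; rewrite prodl_coef.
Qed.

Lemma prodlA0 l a b c : a *_[l] (b *_[0] c) = (a *_[l] b) *_[l] c.
Proof. by rewrite prodlA addr0. Qed.

Lemma prod0A l a b c : a *_[0] (b *_[l] c) = (a *_[0] b) *_[l] c.
Proof. by rewrite prodlA add0r. Qed.

Lemma klinear_dopp : klinear (@dopp k C). Proof. exact: klinear_scale. Qed.

Lemma prodl_dopp l a b :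
  a *_[l] dopp b = dopp (a *_[l] b) - l%:P *: (a *_[l] b).
Proof. by rewrite /dopp !scaleNr prodlNr prodl_dr opprD. Qed.

Lemma dopp_prodl l a b : dopp a *_[l] b = l%:P *: (a *_[l] b).
Proof. by rewrite /dopp scaleNr prodlNl prodl_dl opprK. Qed.

Lemma prodl_iter_dopp l a b i :
  a *_[l] iter i (@dopp k C) b
  = iter i (fun w => dopp w - l%:P *: w) (a *_[l] b).
Proof. by elim: i => //= i IHi; rewrite prodl_dopp IHi. Qed.

(** In a_l (b_μ c) = (a_l b)_(l + μ) c, moving a_l past the powers of ∂ that
    replace μ shifts - ∂ to - ∂ - l, so that l + μ becomes - ∂ as well. *)
Lemma prodl_prodd l a b c : a *_[l] (b *_d c) = (a *_[l] b) *_d c.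
Proof.
apply: (subst_intertwine (prodl_linr l a) klinear_dopp (l := l)) => // i.
by rewrite prodl_iter_dopp prodl_coef.
Qed.

(** On the left of a product, ∂ acts as - λ. *)
Lemma subst_dopp_prodl l (p : nat -> C) b : lpoly p ->
  subst (@dopp k C) p *_[l] b = ev l p *_[l] b.
Proof.
move=> [N hN]; rewrite (substE klinear_dopp hN) (evE _ hN) !prodl_suml.
apply: eq_bigr => i _; rewrite prodlZl.
move: (p i) => w; elim: (nat_of_ord i) => [|j IHj]; first by rewrite scale1r.
by rewrite iterS dopp_prodl IHj scalerA -polyCM exprS.
Qed.

Lemma prodd_prodl l a b c : (a *_d b) *_[l] c = (a *_[l] b) *_[l] c.
Proof. exact: subst_dopp_prodl. Qed.

Hypothesis char_k : [pchar k] =i pred0.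

Lemma prodd_const a b c : (forall l, a *_[l] b = c) -> a *_d b = c.
Proof.
move=> h; have hc : lprod a b = constp c.
  apply/funext; apply: (ev_inj char_k) => // l.
  by rewrite ev_constp -(h l).
by rewrite /prodd hc subst_constp //; exact: klinear_dopp.
Qed.

Lemma lprod_fixed a b c l i : (forall m, (a *_[m] b) *_[l] c = a *_[m] b) ->
  lprod a b i *_[l] c = lprod a b i.
Proof.
move=> h; have linc := prodl_linl l c.
apply: (ev_inj char_k (p := fun i => lprod a b i *_[l] c)) i => // [|m].
  exact: (lpoly_klinear linc).
by rewrite -(ev_klinear m linc) // -/(prodl _ _ _) h.
Qed.

End ConformalProduct.

(** * Frames *)

Section Frames.
Variables (k : fieldType) (A : confAlgType k) (I : eqType) (o z : I).
Variables (u v : I -> A).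

(** The idempotent u o is a unit for the v j on the left, and for the u i on
    the right. *)
Record preframe : Prop := Preframe {
  frame_o : v o = u o;
  frame_ev : forall l j, u o *_[l] v j = v j;
  frame_ue : forall l i, u i *_[l] u o = u i }.

(** The element X of the last condition is v z *_[0] u z. *)
Record frame : Prop := Frame {
  frame_pre : preframe;
  frame_vu : forall l j i, (j != z) || (i != z) ->
    v j *_[l] u i = if j == i then u o else 0;
  frame_zz : forall l, v z *_[l] u z = v z *_[0] u z + l%:P *: u o }.

(** How far v j *_[l] u i is from its value in a frame, at l = 0; by
    [frame_v_defect] this determines the other values of l. *)
Definition defect j i : A := v j *_[0] u i - if j == i then u o else 0.

Hypothesis huv : preframe.

Lemma frame_ee l : u o *_[l] u o = u o.
Proof. exact: frame_ue. Qed.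

Lemma frame_v_prodl l j x : v j *_[l] x = u o *_[l] (v j *_[0] x).
Proof. by rewrite prodlA0 (frame_ev huv). Qed.

Lemma frame_vu_e l j i : (v j *_[0] u i) *_[l] u o = v j *_[0] u i.
Proof. by rewrite -prod0A (frame_ue huv). Qed.

Lemma frame_v_defect l j i :
  v j *_[l] u i = u o *_[l] defect j i + if j == i then u o else 0.
Proof.
rewrite frame_v_prodl -[v j *_[0] u i](subrK (if j == i then u o else 0)).
rewrite -/(defect j i) prodlDr; congr (_ + _).
by case: eqP => _; rewrite ?prodl0r // frame_ee.
Qed.

Lemma defect_e l j i : defect j i *_[l] u o = defect j i.
Proof.
rewrite prodlBl frame_vu_e; congr (_ - _).
by case: eqP => _; rewrite ?prodl0l // frame_ee.
Qed.

End Frames.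

(** * Lifting frames along square-zero surjections *)

Section Lifting.
Variables (k : fieldType) (char_k : [pchar k] =i pred0).
Variables (E A : confAlgType k) (pr : {linear E -> A}).
Hypothesis pr_lprod : forall a b i, pr (lprod a b i) = lprod (pr a) (pr b) i.
Hypothesis ker_sqr0 : forall a b i, pr a = 0 -> pr b = 0 -> lprod a b i = 0.
Hypothesis pr_surj : forall a, exists b, pr b = a.
Implicit Types (a b c : E) (l m : k).

Lemma klinear_pr : klinear pr.
Proof. by move=> x a b; rewrite linearP. Qed.
Hint Resolve klinear_pr : core.

Lemma pr_prodl l a b : pr (a *_[l] b) = pr a *_[l] pr b.
Proof.
rewrite /prodl ev_klinear //; congr (ev l _).
by apply/funext => i; apply: pr_lprod.
Qed.

Lemma pr_subst_dopp (p : nat -> E) : lpoly p ->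
  pr (subst (@dopp k E) p) = subst (@dopp k A) (fun i => pr (p i)).
Proof.
move=> [N hN]; rewrite (substE (@klinear_dopp _ _) hN).
rewrite (@substE _ _ _ _ N (@klinear_dopp _ _)); last first.
  by move=> i /hN ->; rewrite raddf0.
rewrite raddf_sum; apply: eq_bigr => i _.
by elim: (nat_of_ord i) (p i) => //= j IHj w; rewrite linearZ /= IHj.
Qed.

Lemma pr_prodd a b : pr (a *_d b) = pr a *_d pr b.
Proof.
rewrite /prodd pr_subst_dopp //.
by congr (subst _ _); apply/funext => i; apply: pr_lprod.
Qed.

Lemma ker_prodl l a b : pr a = 0 -> pr b = 0 -> a *_[l] b = 0.
Proof.
move=> ha hb; rewrite /prodl (@evE _ _ _ _ 0) ?big_ord0 // => i _.
exact: ker_sqr0.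
Qed.

Lemma prodl_kerr l a a' b : pr a = pr a' -> pr b = 0 -> a *_[l] b = a' *_[l] b.
Proof.
move=> ha hb; apply/eqP; rewrite -subr_eq0 -prodlBl ker_prodl //.
by rewrite raddfB /= ha subrr.
Qed.

Lemma prodl_kerl l a b b' : pr a = 0 -> pr b = pr b' -> a *_[l] b = a *_[l] b'.
Proof.
move=> ha hb; apply/eqP; rewrite -subr_eq0 -prodlBr ker_prodl //.
by rewrite raddfB /= hb subrr.
Qed.

(** The classical lifting of idempotents for the associative product at 0: if
    a a = a + m, then a m = m a, and a + m - 2 m a is idempotent. *)
Lemma idempotent_lift0 e : e *_[0] e = e ->
  exists2 a, pr a = e & a *_[0] a = a.
Proof.
move=> he; have [a ha] := pr_surj e.
have [m hm aa] : exists2 m, pr m = 0 & a *_[0] a = a + m.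
  exists (a *_[0] a - a); last by rewrite addrC subrK.
  by rewrite raddfB /= pr_prodl ha he subrr.
have Lm : a *_[0] m = m *_[0] a.
  by have := prodlA0 0 a a a; rewrite !aa prodlDl prodlDr aa => /addrI.
have RRm : (m *_[0] a) *_[0] a = m *_[0] a.
  by rewrite -prodlA0; apply: prodl_kerl; rewrite // pr_prodl ha he.
have [n nE] : {n | n = m - (m *_[0] a) *+ 2} by exists (m - (m *_[0] a) *+ 2).
have hn : pr n = 0.
  by rewrite nE raddfB raddfMn /= pr_prodl hm prodl0l mul0rn subrr.
have Ln : a *_[0] n = - (m *_[0] a).
  by rewrite nE mulr2n prodlBr prodlDr prodlA0 Lm RRm opprD addNKr.
have Rn : n *_[0] a = - (m *_[0] a).
  by rewrite nE mulr2n prodlBl prodlDl RRm opprD addNKr.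
exists (a + n); first by rewrite raddfD /= hn addr0.
rewrite prodlDl !prodlDr (ker_prodl 0 hn hn) addr0 aa Ln Rn.
by rewrite nE mulr2n opprD !addrA.
Qed.

(** Take a lift a with a_0 a = a, write a_λ a = a + m(λ), and call x fixed if
    x_λ a = x.  The coefficient of μ in a_λ (a_μ a) = (a_λ a)_(λ + μ) a shows
    that a_λ m_1 - m'(λ) is fixed, where m_1 = m'(0).  Hence m - J is fixed,
    where J(λ) is the integral of a_s m_1 over s from 0 to λ; this is where the
    characteristic matters.  On the other hand m(λ)_λ a = 0, by associativity
    at μ = 0, so that m(λ) = J(λ) - J(λ)_λ a.  As a_l J(μ) = J(l + μ) - J(l),
    the value n of J at - ∂ satisfies a_λ n = n - J(λ) and n_λ a = J(λ)_λ a, so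
    that (a + n)_λ (a + n) = a + n. *)
Lemma idempotent_lift e : (forall l, e *_[l] e = e) ->
  exists2 a, pr a = e & forall l, a *_[l] a = a.
Proof.
move=> he; have [a ha aa] := idempotent_lift0 (he 0).
have pr_aa l : pr (a *_[l] a) = pr a by rewrite pr_prodl ha he.
pose m i := lprod a a i - constp a i.
have lpm : lpoly m by exact: lpolyB.
have evm l : ev l m = a *_[l] a - a by rewrite evB ?ev_constp.
have prm i : pr (m i) = 0.
  apply: (ev_eq0 char_k (p := fun i => pr (m i))) i => [|l].
    exact: lpoly_klinear.
  by rewrite -ev_klinear // evm raddfB /= pr_aa subrr.
have aa0 : lprod a a 0 = a by rewrite -[RHS]aa /prodl ev0.
have m0 : m 0%N = 0 by rewrite /m aa0 subrr.
have mS i : m i.+1 = lprod a a i.+1 by rewrite /m /= subr0.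
pose fixed x := forall l, x *_[l] a = x.
have fixedD x y : fixed x -> fixed y -> fixed (x + y).
  by move=> hx hy l; rewrite prodlDl hx hy.
have fixed0 : fixed 0 by move=> l; rewrite prodl0l.
have fixed_lprod w i : pr w = 0 -> fixed (lprod w a i).
  move=> hw l; apply: (lprod_fixed char_k) => n.
  rewrite -[l](subrK n) addrC -prodlA.
  by apply: prodl_kerl; rewrite // pr_aa.
have fixedMn x i : fixed x -> fixed (x *+ i).
  by move=> hx; elim: i => [|i IHi]; rewrite ?mulrS //; apply: fixedD.
have fixedm i : fixed (lprod a (m 1%N) i - m i.+1 *+ i.+1).
  have := lprodA a a a i 1; rewrite /nested /shifted big_ord_recl /=.
  rewrite subn0 addn1 bin1 aa0 !mS => ->.
  rewrite addrAC subrr add0r; elim/big_ind: _ => // j _.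
  by apply/fixedMn/fixed_lprod; rewrite -mS.
clearbody m.
have evm_r l : ev l m *_[l] a = 0.
  by have := prodlA0 l a a a; rewrite aa evm prodlBl => <-; rewrite subrr.
pose J i := if i is j.+1 then (j.+1%:R^-1 : k)%:P *: lprod a (m 1%N) j else 0.
have lpJ : lpoly J.
  have [N hN] := lpoly_lprod a (m 1%N).
  by exists N.+1 => -[//|i] /= /hN ->; rewrite scaler0.
have prJ i : pr (J i) = 0.
  case: i => [|i] /=; first exact: raddf0.
  rewrite linearZ /= pr_lprod prm (klinear0 (lprod_linr _ _)).
  exact: scaler0.
have n_neq0 n : n.+1%:R != 0 :> k by rewrite (iffLR (GRing.pcharf0P k) char_k).
have fixedI i : fixed (m i - J i).
  case: i => [|i]; first by rewrite m0 subrr.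
  have := fixedm i; rewrite /J => hi l.
  have -> : m i.+1 - (i.+1%:R^-1 : k)%:P *: lprod a (m 1%N) i
     = (- i.+1%:R^-1 : k)%:P *: (lprod a (m 1%N) i - m i.+1 *+ i.+1).
    rewrite polyCN scaleNr scalerBr opprB -[m i.+1 *+ _]scaler_nat.
    have -> : i.+1%:R = (i.+1%:R : k)%:P :> {poly k} by rewrite polyC_natr.
    by rewrite scalerA -polyCM mulVf // scale1r.
  by rewrite prodlZl hi.
have taylorJ l i : taylor l J i.+1 = a *_[l] J i.+1.
  rewrite /= prodlZr prodl_coef.
  have -> : lprod (a *_[l] a) (m 1%N) = lprod a (m 1%N).
    apply/funext => j; apply/eqP; rewrite -subr_eq0; apply/eqP.
    rewrite -(sesqBl lprod_sesquilinear) ker_sqr0 //.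
    by rewrite raddfB /= pr_aa subrr.
  have [N hN] := lpoly_lprod a (m 1%N).
  rewrite (taylorE _ _ hN) (@taylorE _ _ _ _ N.+1); last first.
    by move=> -[//|j] /= /hN ->; rewrite scaler0.
  rewrite big_ord_recl /= scaler0 add0r scaler_sumr; apply: eq_bigr => j _.
  rewrite /bump add1n subSS !scalerA -!polyCM; congr (_%:P *: _).
  rewrite [RHS]mulrC add0n; apply/eqP; rewrite eqr_div // !mulr_natr -!mulrnA.
  by rewrite mulnC -mul_bin_diag mulnC.
pose n := subst (@dopp k E) J.
have Ln l : a *_[l] n = n - ev l J.
  apply: (subst_primitive (L := prodl l a)) => //.
  - exact: prodl_linr.
  - exact: klinear_dopp.
  - by move=> i; rewrite prodl_iter_dopp.
  case=> [|i]; last by rewrite taylorJ subr0.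
  by rewrite taylor0 // subrr /= prodl0r.
have Rn l : n *_[l] a = ev l J *_[l] a by exact: subst_dopp_prodl.
have prn : pr n = 0.
  rewrite /n pr_subst_dopp // (substE (@klinear_dopp _ _) (N := 0)) //.
  exact: big_ord0.
exists (a + n); first by rewrite raddfD /= ha prn addr0.
move=> l; rewrite prodlDl !prodlDr (ker_prodl l prn prn) addr0 Ln Rn.
have hI : (ev l m - ev l J) *_[l] a = ev l m - ev l J.
  rewrite -evB //; have hlin := prodl_linl l a.
  rewrite (ev_klinear l hlin); last exact: lpolyB.
  by congr (ev l _); apply/funext => i; exact: fixedI.
have -> : a *_[l] a = a + ev l m by rewrite evm addrC subrK.
move: hI; rewrite prodlBl evm_r sub0r => /eqP; rewrite eqr_oppLR => /eqP ->.
rewrite opprB -!addrA; congr (_ + _).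
by rewrite addKr addrC subrK.
Qed.

Variables (I : finType) (o z : I) (u0 v0 : I -> A).
Hypotheses (oz : o != z) (huv0 : frame o z u0 v0).
Implicit Types u v : I -> E.

Lemma preframe_lift : exists u v,
  [/\ preframe o u v, forall i, pr (u i) = u0 i & forall j, pr (v j) = v0 j].
Proof.
have [pre0 _ _] := huv0.
have [e he ee] := idempotent_lift (frame_ee pre0).
have /choice[u hu] : forall i, exists x, pr x = u0 i by [].
have /choice[v hv] : forall j, exists x, pr x = v0 j by [].
pose u' i := if i == o then e else u i *_[0] e.
pose v' j := if j == o then e else e *_d v j.
have u'o : u' o = e by rewrite /u' eqxx.
have v'o : v' o = e by rewrite /v' eqxx.
exists u', v'; split.
- split; rewrite ?u'o // => l i; rewrite /u' /v'; case: eqP => // _.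
    by rewrite prodl_prodd ee.
  by rewrite -prod0A ee.
- move=> i; rewrite /u'; case: eqP => [->//|_].
  by rewrite pr_prodl hu he (frame_ue pre0).
- move=> j; rewrite /v'; case: eqP => [->|_]; first by rewrite (frame_o pre0).
  rewrite pr_prodd hv he; apply: (prodd_const char_k) => l.
  exact: frame_ev.
Qed.

Lemma pr_defect u v j i :
  (forall i, pr (u i) = u0 i) -> (forall j, pr (v j) = v0 j) ->
  (j != z) || (i != z) -> pr (defect o u v j i) = 0.
Proof.
move=> hu hv ji; rewrite raddfB /= pr_prodl hu hv (frame_vu huv0) //.
by case: eqP => _; rewrite ?hu ?raddf0 ?subrr ?addr0.
Qed.

(** The columns u i, for i != o, are corrected against the rows j != z by
    subtracting the u j *_[0] defect j i; modulo the kernel v j *_[l] u j is e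
    for these j, so that the product of v j with the correction is e *_[l]
    defect j i. *)
Lemma column_lift u v : preframe o u v ->
  (forall i, pr (u i) = u0 i) -> (forall j, pr (v j) = v0 j) ->
  exists u', [/\ preframe o u' v, forall i, pr (u' i) = u0 i &
    forall l j i, j != z -> i != o ->
      v j *_[l] u' i = if j == i then u' o else 0].
Proof.
move=> huv hu hv; pose e := u o; pose d := defect o u v.
have prd j i : j != z -> pr (d j i) = 0.
  by move=> jz; apply: pr_defect; rewrite ?jz.
pose u' i := if i == o then e else u i - \sum_(j | j != z) u j *_[0] d j i.
have u'o : u' o = e by rewrite /u' eqxx.
exists u'; rewrite u'o; split.
- split; rewrite ?u'o; [exact: (frame_o huv) | exact: (frame_ev huv) |].
  move=> l i; rewrite /u'; case: eqP => _; first exact: (frame_ee huv).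
  rewrite prodlBl (frame_ue huv) prodl_suml; congr (_ - _).
  by apply: eq_bigr => j _; rewrite -prod0A (defect_e huv).
- move=> i; rewrite /u'; case: eqP => [->|_]; first exact: hu.
  rewrite raddfB raddf_sum /= hu big1 ?subr0 // => j jz.
  by rewrite pr_prodl prd // prodl0r.
move=> l j i jz io; rewrite /u' (negbTE io) prodlBr prodl_sumr (bigD1 j) //=.
have vud h : h != z ->
    v j *_[l] (u h *_[0] d h i) = if j == h then e *_[l] d j i else 0.
  move=> hz; rewrite prodlA0.
  transitivity ((if j == h then e else 0) *_[l] d h i).
    apply: prodl_kerr; last exact: prd.
    rewrite pr_prodl hu hv (frame_vu huv0) ?jz //.
    by case: eqP => _; rewrite ?hu ?raddf0.
  by case: eqP => [->|_] //; rewrite prodl0l.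
rewrite vud // eqxx big1 ?addr0 => [|h /andP[hz hj]].
  by rewrite (frame_v_defect huv) [_ + (if _ then _ else _)]addrC addrK.
by rewrite vud // eq_sym (negbTE hj).
Qed.

(** The rows v j, for j != o, are corrected against the columns i != z.  Here
    the correction defect j i *_[0] v i has to be replaced by its product with
    e at λ = - ∂ for v j to remain fixed by e. *)
Lemma row_lift u v : preframe o u v ->
  (forall i, pr (u i) = u0 i) -> (forall j, pr (v j) = v0 j) ->
  (forall l j i, j != z -> i != o ->
     v j *_[l] u i = if j == i then u o else 0) ->
  exists v', [/\ preframe o u v', forall j, pr (v' j) = v0 j &
    forall l j i, (j != z) || (i != z) ->
      v' j *_[l] u i = if j == i then u o else 0].
Proof.
move=> huv hu hv hcol; pose e := u o; pose d := defect o u v.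
have prd j i : i != z -> pr (d j i) = 0.
  by move=> iz; apply: pr_defect; rewrite ?iz ?orbT.
pose v' j :=
  if j == o then e else v j - \sum_(i | i != z) e *_d (d j i *_[0] v i).
have v'o : v' o = e by rewrite /v' eqxx.
exists v'; split.
- split; [exact: v'o | | exact: (frame_ue huv)].
  move=> l j; rewrite /v'; case: eqP => _; first exact: (frame_ee huv).
  rewrite prodlBr (frame_ev huv) prodl_sumr; congr (_ - _).
  by apply: eq_bigr => i _; rewrite prodl_prodd (frame_ee huv).
- move=> j; rewrite /v'; case: eqP => [->|_].
    by rewrite /e -(frame_o huv) hv.
  rewrite raddfB raddf_sum /= hv big1 ?subr0 // => i iz.
  rewrite pr_prodd pr_prodl prd // prodl0l; apply: (prodd_const char_k) => l.
  exact: prodl0r.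
have dvu l j i h : i != z ->
    (e *_d (d j i *_[0] v i)) *_[l] u h = if i == h then e *_[l] d j i else 0.
  move=> iz; rewrite prodd_prodl -!prodlA0.
  have -> : d j i *_[0] (v i *_[0] u h) = if i == h then d j i else 0.
    transitivity (d j i *_[0] (if i == h then e else 0)); last first.
      by case: eqP => _; rewrite ?prodl0r // (defect_e huv).
    apply: prodl_kerl; first exact: prd.
    rewrite pr_prodl hu hv (frame_vu huv0) ?iz //.
    by case: eqP => _; rewrite ?hu ?raddf0.
  by case: eqP => _; rewrite ?prodl0r.
move=> l j i ji; rewrite /v'; have [jo|jo] := eqVneq j o.
  rewrite jo -/e; have [<-|oi] := eqVneq o i; first exact: (frame_ee huv).
  have io : i != o by rewrite eq_sym.
  by rewrite -[e](frame_o huv) hcol // (negbTE oi).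
rewrite prodlBl prodl_suml; have [iz|iz] := eqVneq i z.
  (* The column z is orthogonal to the rows i != z, hence to the corrections. *)
  have jz : j != z by rewrite iz eqxx orbF in ji.
  have zo : z != o by rewrite eq_sym.
  rewrite iz hcol // (negbTE jz) big1 ?subr0 // => h hz.
  by rewrite dvu // (negbTE hz).
rewrite (bigD1 i) //= dvu // eqxx big1 ?addr0 => [|h /andP[hz hi]].
  by rewrite (frame_v_defect huv) [_ + (if _ then _ else _)]addrC addrK.
by rewrite dvu // (negbTE hi).
Qed.

(** Write v z *_[l] u z = X + l e + m(l), so that m(0) = 0 and m is in the
    kernel.  From e_l (v z_μ u z) = v z_(l + μ) u z one gets
    e_l m(μ) = m(l + μ) - m(l), and left multiplication by e intertwines
    T = - X with T - l on the kernel; so the value y of m at T satisfies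
    e_l y = y - m(l).  As m(0) = 0, y is a multiple T s = - X s.  Replacing u z
    by u z - u z s subtracts (X + l e) s = e_l (X s) from the product, i.e. adds
    e_l y = y - m(l), and (X + y) + l e is left. *)
Lemma corner_lift u v : preframe o u v ->
  (forall i, pr (u i) = u0 i) -> (forall j, pr (v j) = v0 j) ->
  (forall l j i, (j != z) || (i != z) ->
     v j *_[l] u i = if j == i then u o else 0) ->
  exists2 u', forall i, pr (u' i) = u0 i & frame o z u' v.
Proof.
move=> huv hu hv hvu; set e := u o; have he : pr e = u0 o by exact: hu.
pose g := lprod (v z) (u z); pose X := v z *_[0] u z.
have lpg : lpoly g by [].
pose c (i : nat) : E := if i is j.+1 then constp e j else X.
have lpc : lpoly c by exists 2%N => -[|[]].
have evc l : ev l c = X + l%:P *: e.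
  rewrite (@evE _ _ _ _ 2) => [|[|[]] //].
  by rewrite big_ord_recl big_ord1 /= scale1r expr1.
pose m i := g i - c i.
have lpm : lpoly m by exact: lpolyB.
have evm l : ev l m = v z *_[l] u z - (X + l%:P *: e) by rewrite evB ?evc.
have m0 : m 0%N = 0 by rewrite /m /= /X /prodl ev0 ?subrr.
have prg l : pr (v z *_[l] u z) = pr (X + l%:P *: e).
  rewrite (klinearD klinear_pr) (klinearZ klinear_pr) he /X !pr_prodl hu hv.
  exact: (frame_zz huv0).
have prm i : pr (m i) = 0.
  apply: (ev_eq0 char_k (p := fun i => pr (m i))) i => [|l].
    exact: lpoly_klinear.
  by rewrite -ev_klinear // evm raddfB /= prg subrr.
pose fixed x := forall l, x *_[l] e = x.
have fixedX : fixed X by move=> l; exact: (frame_vu_e huv).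
have fixede : fixed e by exact: (frame_ee huv).
have fixedm i : fixed (m i).
  move=> l; rewrite prodlBl; congr (_ - _).
    apply: (lprod_fixed char_k) => n.
    by rewrite -[l](subrK n) addrC -prodlA (frame_ue huv).
  by case: i => [|[|i]] //=; rewrite prodl0l.
pose T w := - (X *_[0] w).
have linT : klinear T.
  by move=> a x y; rewrite /T prodlDr prodlZr opprD scalerN.
have fixedT w : fixed w -> fixed (T w).
  by move=> hw l; rewrite /T prodlNl -prod0A hw.
have prT w : pr w = 0 -> pr (T w) = 0.
  by move=> hw; rewrite raddfN /= pr_prodl hw prodl0r oppr0.
have iterT (P : E -> Prop) i w : (forall x, P x -> P (T x)) -> P w ->
  P (iter i T w) by move=> hP hw; elim: i => //= i; exact: hP.
have eX l : e *_[l] X = v z *_[l] u z by rewrite -(frame_v_prodl huv).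
have gw l w : pr w = 0 ->
    (v z *_[l] u z) *_[l] w = X *_[l] w + l%:P *: (e *_[l] w).
  by move=> hw; rewrite (prodl_kerr _ (prg l)) // prodlDl prodlZl.
have eT l w : pr w = 0 -> e *_[l] T w = T (e *_[l] w) - l%:P *: (e *_[l] w).
  move=> hw; rewrite /T prodlNr prodlA0 eX gw // opprD; congr (- _ - _).
  by rewrite prod0A fixedX.
have eiterT l w i : pr w = 0 ->
    e *_[l] iter i T w = iter i (fun x => T x - l%:P *: x) (e *_[l] w).
  move=> hw; elim: i => //= i IHi.
  by rewrite eT ?IHi //; apply: (iterT (fun x => pr x = 0)).
have em l i : e *_[l] m i = taylor l m i - constp (ev l m) i.
  rewrite -(taylor_constp l) -taylorB //.
  apply: (taylor_uniq (p := fun i => e *_[l] m i) char_k) i => [||n].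
  - exact: (lpoly_klinear (prodl_linr l e)).
  - exact: lpolyB.
  have -> : ev (l + n) (fun i => m i - constp (ev l m) i)
      = ev (l + n) m - ev l m by rewrite [LHS]evB ?ev_constp.
  rewrite -(ev_klinear n (prodl_linr l e)) // !evm prodlBr prodlDr prodlZr eX.
  rewrite (frame_ee huv) prodlA (frame_ev huv) polyCD scalerDl.
  have cancel (x y t w : E) : x - (y + t) = x - (w + t) - (y - w).
    by rewrite opprB -addrA !opprD addrACA addNr add0r [- t + _]addrC.
  by rewrite addrA; exact: cancel.
have ey l : e *_[l] subst T m = subst T m - ev l m.
  apply: (subst_primitive (L := prodl l e)) => // [|i].
    exact: prodl_linr.
  by rewrite eiterT.
have [s hs [fixeds prs]] : exists2 s, subst T m = T s & fixed s /\ pr s = 0.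
  have [N hN] := lpm; exists (\sum_(i < N) iter i T (m i.+1)).
    rewrite (substE linT (N := N.+1)) => [|i /ltnW/hN //].
    by rewrite big_ord_recl /= m0 add0r (klinear_sum linT).
  split.
    move=> l; rewrite prodl_suml; apply: eq_bigr => i _.
    exact: (iterT fixed).
  by rewrite raddf_sum big1 // => i _; apply: (iterT (fun x => pr x = 0)).
pose u' i := if i == z then u z - u z *_[0] s else u i.
have u'o : u' o = e by rewrite /u' (negbTE oz).
have u'z : u' z = u z - u z *_[0] s by rewrite /u' eqxx.
have vu'z l : v z *_[l] u' z = X + subst T m + l%:P *: e.
  rewrite u'z prodlBr prodlA0 gw //.
  have -> : X *_[l] s + l%:P *: (e *_[l] s) = - (e *_[l] subst T m).
    by rewrite hs /T prodlNr opprK prodlA0 eX gw.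
  rewrite opprK ey evm opprB addrCA [X + _ + _]addrAC [in RHS]addrC.
  by rewrite [v z *_[l] _ + _]addrC subrK.
exists u'.
  move=> i; rewrite /u'; case: eqP => [->|_ //].
  by rewrite raddfB /= pr_prodl prs prodl0r subr0.
split.
- split; rewrite ?u'o; [exact: (frame_o huv) | exact: (frame_ev huv) |].
  move=> l i; rewrite /u'; case: eqP => _; last exact: (frame_ue huv).
  by rewrite prodlBl (frame_ue huv) -prod0A fixeds.
- move=> l j i; rewrite u'o; have [->|iz] := eqVneq i z; last first.
    by move=> ji; rewrite /u' (negbTE iz) hvu ?iz ?orbT.
  rewrite orbF => jz; rewrite u'z prodlBr prodlA0 hvu ?jz // (negbTE jz).
  by rewrite prodl0l subrr.
- by move=> l; rewrite !vu'z u'o scale0r addr0.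
Qed.

Theorem frame_lift : exists u v,
  [/\ frame o z u v, forall i, pr (u i) = u0 i & forall j, pr (v j) = v0 j].
Proof.
have [u1 [v1 [pre1 hu1 hv1]]] := preframe_lift.
have [u2 [pre2 hu2 col2]] := column_lift pre1 hu1 hv1.
have [v3 [pre3 hv3 row3]] := row_lift pre2 hu2 hv1 col2.
have [u4 hu4 frame4] := corner_lift pre3 hu2 hv3 row3.
by exists u4, v3.
Qed.

End Lifting.

(** * Homomorphisms determined by a frame *)

Section FrameElements.
Variables (k : fieldType) (E : confAlgType k) (I : finType) (o z : I).
Variables (u v : I -> E).

(** [xop] is the multiplication by X = v z *_[0] u z, [xshift] the one by X + l;
    the power X^r stands for an iterate of [xop], as X^0 = e fixes v j. *)
Definition xop (w : E) : E := (v z *_[0] u z) *_[0] w.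
Definition xshift (l : k) (w : E) : E := xop w + l%:P *: w.
Definition frame_elt i r j : E := u i *_[0] iter r xop (v j).

Lemma klinear_xop : klinear xop. Proof. exact: prodl_linr. Qed.

Hypothesis huv : frame o z u v.

Lemma frame_e_xop l w : u o *_[l] xop w = xshift l (u o *_[l] w).
Proof.
have pre := frame_pre huv.
rewrite /xop prodlA0 -(frame_v_prodl pre) (frame_zz huv) prodlDl prodlZl.
by rewrite /xshift /xop prod0A (frame_vu_e pre).
Qed.

Lemma frame_e_iter_xop l r j :
  u o *_[l] iter r xop (v j) = iter r (xshift l) (v j).
Proof.
elim: r => [|r IHr] /=; first exact: (frame_ev (frame_pre huv)).
by rewrite frame_e_xop IHr.
Qed.

(** For j = h = z the product v z *_[l] u z = X + l e contributes one more
    factor X + l. *)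
Lemma frame_v_elt l j h r s :
  v j *_[l] frame_elt h r s =
  if j == h then iter (r + (h == z)) (xshift l) (v s) else 0.
Proof.
have pre := frame_pre huv; rewrite /frame_elt prodlA0.
have [/andP[/eqP-> /eqP->]|] := boolP ((j == z) && (h == z)).
  rewrite eqxx addn1 iterS -frame_e_iter_xop -frame_e_xop /xop prodlA0.
  by rewrite -(frame_v_prodl pre).
rewrite negb_and => jh; rewrite (frame_vu huv) //.
have [jh'|_] := eqVneq j h; last exact: prodl0l.
by move: jh; rewrite jh' orbb => /negbTE ->; rewrite addn0 frame_e_iter_xop.
Qed.

Lemma iter_xop_prodl l r w y : iter r xop w *_[l] y = iter r xop (w *_[l] y).
Proof. by elim: r => //= r IHr; rewrite /xop -prod0A IHr. Qed.

Lemma frame_eltM l i q j h r s :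
  frame_elt i q j *_[l] frame_elt h r s =
  if j == h then
    u i *_[0] iter q xop (iter (r + (h == z)) (xshift l) (v s))
  else 0.
Proof.
rewrite {1}/frame_elt -prod0A iter_xop_prodl frame_v_elt.
by case: eqP => // _; rewrite (klinear0 (klinear_iter q klinear_xop)) prodl0r.
Qed.

(** The value at X of p, a polynomial in x over H, if w r stands for X^r. *)
Definition psum (w : nat -> E) (p : {poly {poly k}}) : E :=
  \sum_(r < size p) p`_r *: w r.

Lemma psumE w (p : {poly {poly k}}) N : (size p <= N)%N ->
  psum w p = \sum_(r < N) p`_r *: w r.
Proof.
move=> pN; apply: (sum_vanishing (F := fun r => p`_r *: w r)) => r hr.
  by rewrite nth_default ?scale0r.
by rewrite nth_default ?scale0r // (leq_trans pN).
Qed.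

Lemma psumP w h p q : psum w (h%:P * p + q) = h *: psum w p + psum w q.
Proof.
pose N := maxn (size p) (size q).
have pN : (size p <= N)%N := leq_maxl _ _.
have qN : (size q <= N)%N := leq_maxr _ _.
rewrite (psumE w pN) (psumE w qN) (@psumE _ _ N).
  rewrite scaler_sumr -big_split; apply: eq_bigr => r _ /=.
  by rewrite coefD coefCM scalerDl scalerA.
rewrite (leq_trans (size_polyD _ _)) // geq_max qN andbT.
by rewrite mul_polyC (leq_trans (size_scale_leq _ _)).
Qed.

End FrameElements.

Section FrameMorphism.
Variables (k : fieldType) (char_k : [pchar k] =i pred0).
Variables (C E : confAlgType k) (I : finType) (o z : I).
Variables (u v : I -> C) (u' v' : I -> E) (f : {linear C -> E}).
Hypotheses (huv : frame o z u v) (huv' : frame o z u' v').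
Hypothesis f_elt : forall i r j,
  f (frame_elt z u v i r j) = frame_elt z u' v' i r j.
Hypothesis span : forall a, exists N (h : I -> I -> nat -> {poly k}),
  a = \sum_i \sum_j \sum_(r < N) h i j r *: frame_elt z u v i r j.

Let linf : klinear f.
Proof. by move=> c x y; rewrite linearP. Qed.

Lemma frame_morph_xshift l i q p s :
  f (u i *_[0] iter q (xop z u v) (iter p (xshift z u v l) (v s))) =
  u' i *_[0] iter q (xop z u' v') (iter p (xshift z u' v' l) (v' s)).
Proof.
elim: p q => [|p IHp] q; first exact: f_elt.
rewrite !iterS {1 3}/xshift.
rewrite !(klinearD (klinear_iter q (@klinear_xop _ _ _ _ _ _))).
rewrite !(klinearZ (klinear_iter q (@klinear_xop _ _ _ _ _ _))) -!iterSr.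
by rewrite !prodlDr !prodlZr (klinearD linf) (klinearZ linf) !IHp.
Qed.

Lemma span_ind (P : C -> Prop) : P 0 -> (forall a b, P a -> P b -> P (a + b)) ->
  (forall (c : k) a, P a -> P (c%:P *: a)) -> (forall a, P a -> P ('X *: a)) ->
  (forall i r j, P (frame_elt z u v i r j)) -> forall a, P a.
Proof.
move=> P0 PD PZ PX Pe a; have [N [h ->]] := span a.
elim/big_ind: _ => // i _; elim/big_ind: _ => // j _.
elim/big_ind: _ => // r _; elim/poly_ind: (h i j r) => [|p c IHp].
  by rewrite scale0r.
by rewrite scalerDl mulrC -scalerA; apply: PD; [apply: PX | apply: PZ].
Qed.

(** One formula [frame_eltM] multiplies the elements of both frames. *)
Lemma frame_morph_prodl l a b : f (a *_[l] b) = f a *_[l] f b.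
Proof.
elim/span_ind: a => [|a a' ha ha'|c a ha|a ha|i q j].
- by rewrite raddf0 !prodl0l raddf0.
- by rewrite raddfD !prodlDl raddfD /= ha ha'.
- by rewrite (klinearZ linf) !prodlZl (klinearZ linf) ha.
- by rewrite linearZ_LR !prodl_dl (klinearN linf) (klinearZ linf) ha.
elim/span_ind: b => [|b b' hb hb'|c b hb|b hb|h r s].
- by rewrite raddf0 !prodl0r raddf0.
- by rewrite raddfD !prodlDr raddfD /= hb hb'.
- by rewrite (klinearZ linf) !prodlZr (klinearZ linf) hb.
- by rewrite linearZ_LR !prodl_dr (klinearD linf) linearZ_LR (klinearZ linf) hb.
rewrite !f_elt (frame_eltM huv) (frame_eltM huv').
by case: eqP => _; rewrite ?raddf0 // frame_morph_xshift.
Qed.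

Lemma frame_morph_lprod a b i : f (lprod a b i) = lprod (f a) (f b) i.
Proof.
apply: (ev_inj char_k (p := fun i => f (lprod a b i))) i => // [|l].
  exact: lpoly_klinear.
by rewrite -ev_klinear // -/(prodl _ _ _) frame_morph_prodl.
Qed.

End FrameMorphism.

(** * The standard frame of Cend_(n,Q) *)

Section StandardFrame.
Variables (k : fieldType) (n : nat).

Local Notation R := {poly {poly k}}.
Local Notation Q := (diag1x k n).
Local Notation C := (cendQ Q).

Definition xpoly : {poly k} -> R := map_poly polyC.

Definition diag1x_entry (i : 'I_n) : {poly k} := if i.+1 == n then 'X else 1.
Local Notation q := diag1x_entry.

Fact xE_subproof (f : {poly k}) (i j : 'I_n) :
  (xpoly (q i * f) *: delta_mx i j : 'M[R]_n) \in in_cendQ Q.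
Proof.
apply/asboolP; exists (xpoly f *: delta_mx i j).
rewrite -scalemxAr; apply/matrixP => a b; rewrite !mxE.
rewrite (bigD1 i) //= big1 ?addr0 => [|t ti]; last first.
  by rewrite !mxE (negbTE ti) mulr0.
rewrite !mxE eqxx /=; have [->|ai] := eqVneq a i; last first.
  by rewrite mulr0 [_ *+ false]mulr0n rmorph0 mul0r mulr0.
rewrite [_ *+ true]mulr1n /xpoly rmorphM mulrA -/(q i).
by rewrite [map_poly _ f * _]mulrC.
Qed.

(** The matrix Q f(x) E_ij. *)
Definition xE f i j : C := CendQ (xE_subproof f i j).

Definition entry a b (A : C) : R := val A a b.

Lemma entry_scale a b (h : {poly k}) (A : C) :
  entry a b (h *: A) = h *: entry a b A.
Proof. by rewrite /entry linearZ /= mxE mul_polyC. Qed.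

Lemma klinear_entry a b : klinear (entry a b).
Proof. by move=> c A B; rewrite -entry_scale /entry linearD mxE. Qed.

Lemma entryP (A B : C) : (forall a b, entry a b A = entry a b B) -> A = B.
Proof. by move=> h; apply: val_inj; apply/matrixP => a b; exact: h. Qed.

Lemma entry_prodl l (A B : C) a b :
  entry a b (A *_[l] B) = (cend_prod (val A) (val B) a b).[l%:P%:P].
Proof.
rewrite /prodl (ev_klinear _ (klinear_entry a b)) //.
set p := cend_prod _ _ a b.
have -> : (fun i => entry a b (lprod A B i)) = fun i => p`_i.
  by apply/funext => i; rewrite /entry [LHS]cend_lprodE.
rewrite (@evE _ _ _ _ (size p)) => [|i hi]; last by rewrite nth_default.
rewrite horner_coef; apply: eq_bigr => i _.
by rewrite -!polyC_exp mulrC mul_polyC.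
Qed.

Lemma horner_evall_xpoly (l : k) f : (evall k (xpoly f)).[l%:P%:P] = xpoly f.
Proof.
elim/poly_ind: f => [|f c IHf]; first by rewrite /xpoly !rmorph0 horner0.
rewrite /xpoly !rmorphD !rmorphM /= hornerD hornerM IHf map_polyX.
by rewrite map_polyC /= eval2X eval2CC /= !hornerC.
Qed.

Lemma horner_evalr_xpoly (l : k) f :
  (evalr k (xpoly f)).[l%:P%:P] = xpoly (f \Po ('X + l%:P)).
Proof.
elim/poly_ind: f => [|f c IHf].
  by rewrite /xpoly comp_poly0 !rmorph0 horner0.
rewrite /xpoly !rmorphD !rmorphM /= hornerD hornerM IHf map_polyX.
rewrite map_polyC /= eval2X eval2CC /= hornerD !hornerC hornerX.
by rewrite comp_polyX comp_polyC rmorphD /= map_polyX !map_polyC.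
Qed.

Lemma cend_prod_delta (p p' : R) (i j h s a b : 'I_n) :
  cend_prod (p *: delta_mx i j : 'M[R]_n) (p' *: delta_mx h s : 'M[R]_n) a b
  = evall k p * evalr k p' *+ ((j == h) && ((a == i) && (b == s))).
Proof.
rewrite /cend_prod !map_mxZ !map_delta_mx -scalemxAl -scalemxAr.
rewrite mul_delta_mx_cond mxE mxE mulmxnE mxE.
by rewrite mulrA -mulrnA mulr_natr mulnb andbC.
Qed.

Lemma xE_prodl l f i j g h s : xE f i j *_[l] xE g h s =
  if j == h then xE (f * ((q h * g) \Po ('X + l%:P))) i s else 0.
Proof.
apply: entryP => a b; rewrite entry_prodl [val _]/(xE f i j : cend k n).
rewrite (cend_prod_delta (xpoly (q i * f)) (xpoly (q h * g)) i j h s).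
rewrite hornerMn hornerM horner_evall_xpoly horner_evalr_xpoly -rmorphM /=.
case: eqP => _ /=; last by rewrite (klinear0 (klinear_entry a b)).
by rewrite /entry /= !mxE -mulr_natr mulrA.
Qed.

Hypothesis n_gt1 : (1 < n)%N.

Definition first_index : 'I_n := Ordinal (ltnW n_gt1).

Fact last_subproof : (n.-1 < n)%N. Proof. by rewrite prednK // ltnW. Qed.
Definition last_index : 'I_n := Ordinal last_subproof.

Local Notation o := first_index.
Local Notation z := last_index.

Definition std_u i : C := xE 1 i o.
Definition std_v j : C := xE 1 o j.

Lemma first_neq_last : o != z.
Proof.
by rewrite -val_eqE /= -(eqn_add2r 1) !addn1 prednK ?ltn_eqF // ltnW.
Qed.

Lemma diag1x_entryE i : q i = if i == z then 'X else 1.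
Proof. by rewrite /diag1x_entry -val_eqE /= -[in RHS]eqSS prednK // ltnW. Qed.

Lemma diag1x_entry_o : q o = 1.
Proof. by rewrite diag1x_entryE (negbTE first_neq_last). Qed.

Lemma std_vu l j i : std_v j *_[l] std_u i =
  if j == i then xE (q i \Po ('X + l%:P)) o o else 0.
Proof. by rewrite xE_prodl mul1r mulr1. Qed.

Lemma std_X : std_v z *_[0] std_u z = xE 'X o o.
Proof. by rewrite std_vu eqxx diag1x_entryE eqxx addr0 comp_polyXr. Qed.

Lemma xE_affine l : xE ('X + l%:P) o o = xE 'X o o + l%:P *: xE 1 o o.
Proof.
apply: entryP => a b; rewrite (klinearD (klinear_entry a b)).
rewrite (klinearZ (klinear_entry a b)) /entry /= diag1x_entry_o !mul1r !mxE.
rewrite -mul_polyC mulrA -mulrDl; congr (_ * _).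
by rewrite /xpoly rmorphD rmorph1 mulr1 /= map_polyC.
Qed.

Lemma std_frame : frame o z std_u std_v.
Proof.
split.
- split=> //.
    by move=> l j; rewrite xE_prodl eqxx diag1x_entry_o mulr1 comp_polyC mulr1.
  by move=> l i; rewrite xE_prodl eqxx diag1x_entry_o mulr1 comp_polyC mulr1.
- move=> l j i ji; rewrite std_vu; have [jE|//] := eqVneq j i.
  by move: ji; rewrite jE orbb diag1x_entryE => /negbTE ->; rewrite comp_polyC.
- move=> l; rewrite std_X std_vu eqxx diag1x_entryE eqxx comp_polyX.
  exact: xE_affine.
Qed.

Lemma std_elt i r j : frame_elt z std_u std_v i r j = xE 'X^r i j.
Proof.
rewrite /frame_elt.
have -> : iter r (xop z std_u std_v) (std_v j) = xE 'X^r o j.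
  elim: r => [|r IHr] //=; rewrite IHr /xop std_X xE_prodl eqxx diag1x_entry_o.
  by rewrite mul1r addr0 comp_polyXr exprS.
by rewrite xE_prodl eqxx diag1x_entry_o !mul1r addr0 comp_polyXr.
Qed.

(** The (i, j) entry of B, where A = Q B. *)
Definition coord (i j : 'I_n) (A : C) : R := drop_poly (i == z) (entry i j A).

Lemma coordP i j h (A B : C) :
  coord i j (h *: A + B) = h%:P * coord i j A + coord i j B.
Proof.
rewrite /coord mul_polyC -linearP; congr (drop_poly _ _).
by rewrite -entry_scale /entry linearD mxE.
Qed.

Lemma entry_coord i j (A : C) : entry i j A = xpoly (q i) * coord i j A.
Proof.
rewrite /coord /entry /=; have /asboolP[B ->] := cendQ_valP A.
rewrite mxE (bigD1 i) //= big1 ?addr0 => [|t ti]; last first.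
  by rewrite !mxE [i == t]eq_sym (negbTE ti) [_ *+ false]mulr0n rmorph0 mul0r.
rewrite !mxE eqxx [_ *+ true]mulr1n -/(q i) -/(xpoly _) diag1x_entryE.
case: eqP => _ /=; rewrite /xpoly; last by rewrite rmorph1 !mul1r drop_poly0l.
rewrite map_polyX; congr (_ * _).
by rewrite mulrC -[X in _ * X]expr1 drop_polyMXn_id.
Qed.

(** The H-linear map sending q_i x^r E_ij to u_i X^r v_j. *)
Definition frame_map (E : confAlgType k) (u v : 'I_n -> E) (A : C) : E :=
  \sum_i \sum_j psum (fun r => frame_elt z u v i r j) (coord i j A).

Fact frame_map_linear (E : confAlgType k) (u v : 'I_n -> E) :
  linear (frame_map u v).
Proof.
move=> h A B; rewrite /frame_map scaler_sumr -big_split; apply: eq_bigr => i _.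
rewrite scaler_sumr -big_split; apply: eq_bigr => j _ /=.
by rewrite coordP psumP.
Qed.
HB.instance Definition _ (E : confAlgType k) (u v : 'I_n -> E) :=
  GRing.isLinear.Build {poly k} C E _ (frame_map u v) (frame_map_linear u v).

Lemma frame_map_std A : frame_map std_u std_v A = A.
Proof.
apply: entryP => a b; rewrite /frame_map (klinear_sum (klinear_entry a b)).
have entry_xE f i j : entry a b (xE f i j)
    = xpoly (q i * f) * ((a == i) && (b == j))%:R.
  by rewrite /entry /= !mxE.
rewrite (bigD1 a) //= [X in _ + X]big1 ?addr0 => [|i ia]; last first.
  rewrite (klinear_sum (klinear_entry a b)) big1 // => j _.
  rewrite /psum (klinear_sum (klinear_entry a b)) big1 // => r _.
  rewrite entry_scale std_elt entry_xE [a == i]eq_sym (negbTE ia) mulr0.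
  exact: scaler0.
rewrite (klinear_sum (klinear_entry a b)) (bigD1 b) //=.
rewrite [X in _ + X]big1 ?addr0 => [|j jb]; last first.
  rewrite /psum (klinear_sum (klinear_entry a b)) big1 // => r _.
  rewrite entry_scale std_elt entry_xE eqxx [b == j]eq_sym (negbTE jb) mulr0.
  exact: scaler0.
rewrite [RHS]entry_coord -[in RHS](coefK (coord a b A)) poly_def mulr_sumr.
rewrite /psum (klinear_sum (klinear_entry a b)); apply: eq_bigr => r _.
rewrite entry_scale std_elt entry_xE !eqxx mulr1 -scalerAr; congr (_ *: _).
by rewrite /xpoly rmorphM rmorphXn /= map_polyX.
Qed.

Lemma frame_map_elt (E : confAlgType k) (u v : 'I_n -> E) i r j :
  frame_map u v (frame_elt z std_u std_v i r j) = frame_elt z u v i r j.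
Proof.
have coordE a b : coord a b (xE 'X^r i j) = 'X^r *+ ((a == i) && (b == j)).
  rewrite /coord /entry /= !mxE diag1x_entryE mulr_natr.
  have [->|ai] := eqVneq a i; last by rewrite !mulr0n raddf0.
  rewrite raddfMn /=; congr (_ *+ _).
  case: eqP => _ /=; rewrite /xpoly; last first.
    by rewrite mul1r rmorphXn /= map_polyX drop_poly0l.
  rewrite -exprS exprSr rmorphM rmorphXn /= map_polyX.
  by rewrite -[X in _ * X]expr1 drop_polyMXn_id.
have psum0 w : @psum k E w 0 = 0 by rewrite /psum size_poly0 big_ord0.
rewrite std_elt /frame_map (bigD1 i) //=.
rewrite [X in _ + X]big1 ?addr0 => [|a ai]; last first.
  by rewrite big1 // => b _; rewrite coordE (negbTE ai) psum0.
rewrite (bigD1 j) //= [X in _ + X]big1 ?addr0 => [|b bj]; last first.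
  by rewrite coordE (negbTE bj) andbF psum0.
rewrite coordE !eqxx /psum size_polyXn big_ord_recr /= big1 => [|s _].
  by rewrite add0r coefXn eqxx scale1r.
by rewrite coefXn ltn_eqF ?scale0r.
Qed.

Lemma std_span (A : C) : exists N (h : 'I_n -> 'I_n -> nat -> {poly k}),
  A = \sum_i \sum_j \sum_(r < N) h i j r *: frame_elt z std_u std_v i r j.
Proof.
exists (\max_i \max_j size (coord i j A)), (fun i j r => (coord i j A)`_r).
rewrite -[LHS]frame_map_std; apply: eq_bigr => i _; apply: eq_bigr => j _.
apply: psumE.
apply: leq_trans (leq_bigmax (F := fun i => \max_j size (coord i j A)) i).
exact: (leq_bigmax (F := fun j => size (coord i j A)) j).
Qed.

End StandardFrame.

(** * Square-zero extensions and cocycles *)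

Section Splitting.
Variables (k : fieldType) (char_k : [pchar k] =i pred0).
Variables (n : nat) (n_gt1 : (1 < n)%N).
Local Notation C := (cendQ (diag1x k n)).
Variables (E : confAlgType k) (pr : {linear E -> C}).
Hypothesis pr_lprod : forall a b i, pr (lprod a b i) = lprod (pr a) (pr b) i.
Hypothesis ker_sqr0 : forall a b i, pr a = 0 -> pr b = 0 -> lprod a b i = 0.
Hypothesis pr_surj : forall a, exists b, pr b = a.

(** The frame lifted from the standard one defines the section. *)
Theorem square_zero_splits : exists s : {linear C -> E},
  (forall a, pr (s a) = a) /\
  (forall a b i, s (lprod a b i) = lprod (s a) (s b) i).
Proof.
have [u [v [huv hu hv]]] :=
  frame_lift char_k pr_lprod ker_sqr0 pr_surj
    (first_neq_last n_gt1) (std_frame k n_gt1).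
exists (frame_map n_gt1 u v); split=> [a|]; last first.
  apply: (frame_morph_lprod char_k (std_frame k n_gt1) huv).
  - exact: frame_map_elt.
  - exact: std_span.
rewrite -[RHS](frame_map_std n_gt1) /= /frame_map !raddf_sum.
apply: eq_bigr => i _; rewrite raddf_sum; apply: eq_bigr => j _.
rewrite raddf_sum; apply: eq_bigr => r _.
apply: etrans (linearZ_LR pr _ _) _; congr (_ *: _).
rewrite (pr_prodl pr_lprod) hu; congr (_ *_[_] _).
elim: (nat_of_ord r) => [|m IHm] /=; first exact: hv.
by rewrite /xop !(pr_prodl pr_lprod) IHm hu hv.
Qed.

End Splitting.

Section SquareZeroExtension.
Variables (k : fieldType) (C : confAlgType k) (M : confBimodType C).
Variables (phi : cochain2 M) (hphi : cocycle2 phi).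

(** The type records the cocycle, on which its conformal algebra structure
    depends. *)
Definition sqz : Type := let _ := hphi in (C * M)%type.
HB.instance Definition _ := GRing.Lmodule.copy sqz (C * M)%type.

Definition sqz_lprod (a b : sqz) (i : nat) : sqz :=
  (lprod a.1 b.1 i, lact a.1 b.2 i + ract a.2 b.1 i + phi a.1 b.1 i).

Let hC := @lprod_sesquilinear k C.
Let hL := @lact_sesquilinear k C M.
Let hR := @ract_sesquilinear k C M.
Let hP := cocycle2_sesquilinear hphi.

Fact sqz_lprod_sesquilinear : sesquilinear sqz_lprod.
Proof.
split.
- move=> a b; have [N1 h1] := sesq_lpoly hC a.1 b.1.
  have [N2 h2] := sesq_lpoly hL a.1 b.2.
  have [N3 h3] := sesq_lpoly hR a.2 b.1.
  have [N4 h4] := sesq_lpoly hP a.1 b.1.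
  exists (maxn (maxn N1 N2) (maxn N3 N4)) => i.
  rewrite !geq_max => /andP[/andP[i1 i2] /andP[i3 i4]].
  by rewrite /sqz_lprod h1 // h2 // h3 // h4 // !addr0.
- move=> c a a' b i; congr (_, _); first exact: (sesq_linl hC).
  rewrite /= (sesq_linl hL) (sesq_linl hR) (sesq_linl hP) !scalerDr.
  by rewrite [LHS](AC (2*2*2) ((1*3*5)*(2*4*6))).
- move=> c a b b' i; congr (_, _); first exact: (sesq_linr hC).
  rewrite /= (sesq_linr hL) (sesq_linr hR) (sesq_linr hP) !scalerDr.
  by rewrite [LHS](AC (2*2*2) ((1*3*5)*(2*4*6))).
- move=> a b i; rewrite /sqz_lprod /=.
  rewrite (sesq_dl hC) (sesq_dl hL) (sesq_dl hR) (sesq_dl hP).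
  by case: i => [|i] /=; rewrite -?opprD // !addr0.
- move=> a b i; rewrite /sqz_lprod /=.
  rewrite (sesq_dr hC) (sesq_dr hL) (sesq_dr hR) (sesq_dr hP).
  case: i => [|i] /=; first by rewrite !addr0 -!scalerDr.
  congr (_, _); rewrite /= !scalerDr.
  by rewrite [LHS](AC (2*2*2) ((1*3*5)*(2*4*6))).
Qed.

(** The second component is the cocycle identity, added to the three identities
    of a bimodule. *)
Fact sqz_lprodA a b c i j :
  nested sqz_lprod sqz_lprod a b c i j = shifted sqz_lprod sqz_lprod a b c i j.
Proof.
have sum_sqz (F : nat -> sqz) m : \sum_(l < m) F l
    = (\sum_(l < m) (F l).1, \sum_(l < m) (F l).2) :> sqz.
  elim: m => [|m IHm]; first by rewrite !big_ord0.
  by rewrite !big_ord_recr /= IHm.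
have mulrn_sqz (x : sqz) m : x *+ m = (x.1 *+ m, x.2 *+ m) :> sqz.
  by elim: m => // m IHm; rewrite !mulrS IHm.
rewrite /shifted (sum_sqz (fun l =>
  sqz_lprod (sqz_lprod a b l) c (i - l + j) *+ 'C(i - l + j, j))).
rewrite /nested /sqz_lprod /=; congr (_, _).
  rewrite -[LHS]/(nested _ _ _ _ _ _ _) lprodA.
  by apply: eq_bigr => l _; rewrite mulrn_sqz.
transitivity (shifted lact lprod a.1 b.1 c.2 i j
    + (shifted ract lact a.1 b.2 c.1 i j + shifted ract ract a.2 b.1 c.1 i j
       + shifted ract phi a.1 b.1 c.1 i j) + shifted phi lprod a.1 b.1 c.1 i j).
  have lD := klinearD (sesq_klinearr hL a.1 i).
  rewrite !lD -lactA -lractA -ractA /nested.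
  have := cocycle2E hphi a.1 b.1 c.1 i j; rewrite /nested.
  move=> /eqP; rewrite subr_eq0 addrAC subr_eq => /eqP E.
  rewrite -!addrA; congr (_ + (_ + _)); rewrite addrCA; congr (_ + _).
  by rewrite E.
rewrite /shifted -!big_split; apply: eq_bigr => l _ /=.
rewrite mulrn_sqz /= -!mulrnDl.
by rewrite !(klinearD (sesq_klinearl hR c.1 _)).
Qed.

HB.instance Definition _ :=
  isConfAlg.Build k sqz sqz_lprod_sesquilinear sqz_lprodA.

Fact fst_linear : linear (fst : sqz -> C). Proof. by []. Qed.
Definition sqz_fst (a : sqz) : C := a.1.
HB.instance Definition _ :=
  GRing.isLinear.Build {poly k} sqz C _ sqz_fst fst_linear.

Lemma sqz_split_coboundary (s : {linear C -> sqz}) :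
  (forall a, sqz_fst (s a) = a) ->
  (forall a b i, s (lprod a b i) = lprod (s a) (s b) i) ->
  exists tau, phi = d1 tau.
Proof.
move=> hs hm; pose t a : M := - (s a).2.
have tlin : linear t.
  by move=> h a b; rewrite /t linearP /= opprD scalerN.
pose tL := GRing.isLinear.Build {poly k} C M _ t tlin.
pose tau : {linear C -> M} := HB.pack t tL.
exists tau; apply/funext => a; apply/funext => b; apply/funext => i.
rewrite /d1 /= /t.
have := congr1 snd (hm a b i); rewrite /= => ->.
rewrite [(s a).1]hs [(s b).1]hs.
rewrite (klinearN (sesq_klinearr hL a i)) (klinearN (sesq_klinearl hR b i)).
by rewrite opprK !addrA addNr add0r addrAC subrr add0r.
Qed.

Lemma sqz_ker_sqr0 (a b : sqz) i :
  sqz_fst a = 0 -> sqz_fst b = 0 -> lprod a b i = 0.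
Proof.
rewrite /sqz_fst => ha hb; rewrite [LHS]/(sqz_lprod a b i) /sqz_lprod ha hb.
rewrite (klinear0 (sesq_klinearl lprod_sesquilinear _ _)).
rewrite (klinear0 (sesq_klinearl lact_sesquilinear _ _)).
rewrite (klinear0 (sesq_klinearr ract_sesquilinear _ _)).
by rewrite (klinear0 (sesq_klinearl (cocycle2_sesquilinear hphi) _ _)) !addr0.
Qed.

End SquareZeroExtension.

Theorem theorem5 (k : closedFieldType) (char_k : [pchar k] =i pred0)
    (n : nat) (n_gt1 : (1 < n)%N)
    (M : confBimodType (cendQ (diag1x k n))) :
  forall h : H2 M, h = 0.
Proof.
move=> h; rewrite -[h]reprK -[RHS](raddf0 (\pi_(H2 M)%qT)).
apply/eqP; rewrite -Quotient.idealrBE subr0; apply/asboolP.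
have /asboolP hphi := Z2valP (repr h).
have pr_lprod (a b : sqz hphi) i :
  sqz_fst (lprod a b i) = lprod (sqz_fst a) (sqz_fst b) i by [].
have pr_surj a : exists b : sqz hphi, sqz_fst b = a by exists (a, 0).
have [s [hs hm]] :=
  square_zero_splits char_k n_gt1 pr_lprod (@sqz_ker_sqr0 _ _ _ _ hphi) pr_surj.
exact: (sqz_split_coboundary hs hm).
Qed.
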